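(* Let $n$ be a positive integer relatively prime to $6$ such that $n\not\equiv\pm1\pmod{9}$ and no exponent in the prime factorization of $n$ is a multiple of $3$. Let $n'$ be the largest squarefree divisor of $n$. For any $s\in\mathbb{C}$ with $\operatorname{Re} s>1$, \[F(\omega,s)=\frac{2\pi n'\sigma(n/n')}{3(1-3^{-2s})}\bigg(\frac{\sqrt{3}}{2}\bigg)^s\frac{L_k(s,\chi)}{\zeta(2s)}\prod_{p\mid n}\frac{1-p^{-2}}{1-p^{-2s}},\] where $L_k(s,\chi)$ is the Dirichlet $L$-function of $k$ with character $\chi\colon(\mathscr{O}_k/3n\mathscr{O}_k)^\times\to\mathbb{C}^\times$ such that $\chi(z)=\prod_i\big(\frac{z}{\lambda_i}\big)_3^{c_i}$.
   Context: Let $\omega\coloneqq e^{2\pi i/3}$, $k\coloneqq\mathbb{Q}(\omega)$, and $n=\prod_i\lambda_i^{c_i}$ the prime factorization of $n$ in $\mathscr{O}_k=\mathbb{Z}[\omega]$; $(\frac{\cdot}{\lambda})_3$ is the cubic residue symbol. Let $f(d)\coloneqq d\prod_{p\mid d}[1-p^{-1}(\frac{p}{3})]$. For coprime integers $\alpha,\beta$ let $\delta\coloneqq\gcd(n,\alpha^2+\alpha\beta+\beta^2)$ and \[C(\alpha,\beta)\coloneqq\sum_{\substack{d\mid n\\\gcd(d,\delta)=1}}d^2\frac{f(n)}{3f(d)}\prod_{p\mid d}(1-p^{-2})+\frac{2}{3}\operatorname{Re}\prod_i\Big(\frac{\alpha-\beta\omega}{\lambda_i}\Big)_3^{c_i}\sum_{n'\mid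 d\mid n}dn\prod_{p\mid d}(1-p^{-2}).\] With $T=\begin{bmatrix}1&1\\0&1\end{bmatrix}$, $S=\begin{bmatrix}0&-1\\1&0\end{bmatrix}$, and $\Gamma(3)=\{\gamma\in\mathrm{SL}_2\mathbb{Z}:\gamma\equiv\mathbb{I}_2\pmod 3\}$, define for $\tau\in\mathbb{H}$, $\operatorname{Re}s>1$, \[F(\tau,s)\coloneqq\frac{2\pi}{3n}\sum_{\gamma=\begin{bmatrix}a&b\\c&d\end{bmatrix}\in\langle T^3\rangle\backslash\Gamma(3)}C(d,-c)(\operatorname{Im}\gamma\tau)^s-C(c,d)(\operatorname{Im}\gamma S\tau)^s.\] *)

(* Defs.v *)
From HB Require Import structures.
From mathcomp Require Import all_boot all_order all_algebra finmap.
From mathcomp Require Import all_classical all_reals all_analysis.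
From mathcomp Require Import showcase.summability.
From mathcomp Require Import complex ring.

Set Implicit Arguments.
Unset Strict Implicit.
Unset Printing Implicit Defensive.

Import Order.TTheory GRing.Theory Num.Theory.
Import numFieldNormedType.Exports.

Local Open Scope classical_set_scope.
Local Open Scope ring_scope.
Local Open Scope complex_scope.

(* The ring of integers Z[w], w ^+ 2 + w + 1 = 0; [Eis a b] is a + b * w. *)

Record eis := Eis { eis_re : int; eis_om : int }.

Definition eis_pair (z : eis) : int * int := (eis_re z, eis_om z).
Definition pair_eis (p : int * int) : eis := Eis p.1 p.2.

Lemma eis_pairK : cancel eis_pair pair_eis.
Proof. by case. Qed.

HB.instance Definition _ := Choice.copy eis (can_type eis_pairK).

Definition eis_add (x y : eis) : eis :=
  Eis (eis_re x + eis_re y) (eis_om x + eis_om y).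
Definition eis_opp (x : eis) : eis := Eis (- eis_re x) (- eis_om x).
Definition eis_mul (x y : eis) : eis :=
  Eis (eis_re x * eis_re y - eis_om x * eis_om y)
      (eis_re x * eis_om y + eis_om x * eis_re y - eis_om x * eis_om y).

Lemma eis_addA : associative eis_add.
Proof. by move=> [? ?] [? ?] [? ?]; rewrite /eis_add /= !addrA. Qed.
Lemma eis_addC : commutative eis_add.
Proof. by move=> [a b] [c d]; rewrite /eis_add /= addrC [b + d]addrC. Qed.
Lemma eis_add0 : left_id (Eis 0 0) eis_add.
Proof. by case=> a b; rewrite /eis_add /= !add0r. Qed.
Lemma eis_addN : left_inverse (Eis 0 0) eis_opp eis_add.
Proof. by case=> a b; rewrite /eis_add /= !addNr. Qed.

HB.instance Definition _ :=
  GRing.isZmodule.Build eis eis_addA eis_addC eis_add0 eis_addN.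

Lemma eis_mulA : associative eis_mul.
Proof. by move=> [? ?] [? ?] [? ?]; rewrite /eis_mul /=; congr Eis; ring. Qed.
Lemma eis_mulC : commutative eis_mul.
Proof. by move=> [? ?] [? ?]; rewrite /eis_mul /=; congr Eis; ring. Qed.
Lemma eis_mul1 : left_id (Eis 1 0) eis_mul.
Proof. by move=> [? ?]; rewrite /eis_mul /=; congr Eis; ring. Qed.
Lemma eis_mulD : left_distributive eis_mul +%R.
Proof.
by move=> [? ?] [? ?] [? ?]; rewrite /eis_mul /=; congr Eis => /=; ring.
Qed.
Lemma eis_1neq0 : Eis 1 0 != 0 :> eis.
Proof. by apply/eqP => -[]. Qed.

HB.instance Definition _ := GRing.Zmodule_isComNzRing.Build eis
  eis_mulA eis_mulC eis_mul1 eis_mulD eis_1neq0.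

Definition eis_norm (z : eis) : nat :=
  absz (eis_re z ^+ 2 - eis_re z * eis_om z + eis_om z ^+ 2).

Definition eis_dvd (x y : eis) : Prop := exists w, y = w * x.

Definition eis_prime (p : eis) : Prop :=
  [/\ p <> 0, ~ eis_dvd p 1 &
      forall x y, eis_dvd p (x * y) -> eis_dvd p x \/ eis_dvd p y].

Definition eis_prime_factorization (n m : nat)
    (lam : 'I_m -> eis) (c : 'I_m -> nat) : Prop :=
  [/\ forall i, eis_prime (lam i),
      forall i j, i != j -> ~ eis_dvd (lam i) (lam j),
      forall i, (0 < c i)%N &
      n%:R = \prod_i lam i ^+ c i].

(* Intended for a prime [lam] not dividing 3: 0 if lam | z, and otherwise the
   cube root of unity congruent to z ^ ((N lam - 1) / 3) modulo lam. *)
Definition cubic_residue (z lam : eis) : eis :=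
  if `[< eis_dvd lam z >] then 0
  else xget 0 [set u | u ^+ 3 = 1 /\
                       eis_dvd lam (z ^+ ((eis_norm lam).-1 %/ 3) - u)].

Definition chi (m : nat) (lam : 'I_m -> eis) (c : 'I_m -> nat) (z : eis) : eis :=
  \prod_i cubic_residue z (lam i) ^+ c i.

Definition expC (R : realType) (z : R[i]) : R[i] :=
  (expR (complex.Re z))%:C * (cos (complex.Im z) +i* sin (complex.Im z)).

(* x ^ s for a real x > 0, with the real logarithm. *)
Definition cpow (R : realType) (x : R) (s : R[i]) : R[i] :=
  expC (s * (ln x)%:C).

Definition omega (R : realType) : R[i] := expC (0 +i* (2 * pi / 3)).

Definition eisC (R : realType) (z : eis) : R[i] :=
  (eis_re z)%:~R + (eis_om z)%:~R * omega R.

(* Unordered sum over [D]: the limit of the net of finite partial sums. *)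
Definition csum (R : realType) (T : choiceType) (D : set T) (f : T -> R[i]) :
  R[i] := summability.sum (fun x : D => f (val x) : R[i]^o).

Definition zeta (R : realType) (s : R[i]) : R[i] :=
  csum [set m | (0 < m)%N] (fun m : nat => cpow (m%:R : R) (- s)).

Definition is_ideal (I : set eis) : Prop :=
  [/\ I 0, forall x y, I x -> I y -> I (x + y) & forall a x, I x -> I (a * x)].

Definition ideal_coprime (I : set eis) (m : nat) : Prop :=
  exists2 x, I x & exists y, x + m%:R * y = 1.

(* The index of I in Z[w]; it is 0 when the index is infinite. *)
Definition ideal_norm (I : set eis) : nat :=
  #|` fset_set [set [set y | I (y - x)] | x in [set: eis]] |.

Definition primary_gen (I : set eis) : eis :=
  xget 0 [set z | I = [set w * z | w in [set: eis]] /\ eis_dvd 3 (z - 1)].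

(* Sum over the ideals I prime to the modulus [m], a multiple of 3.  As [psi]
   is a function on residues that need not be trivial on the units of Z[w], its
   value at I is taken at the generator congruent to 1 modulo 3, which exists
   and is unique for every ideal prime to 3. *)
Definition Lk (R : realType) (m : nat) (psi : eis -> R[i]) (s : R[i]) : R[i] :=
  csum [set I | is_ideal I /\ ideal_coprime I m]
    (fun I => psi (primary_gen I) * cpow ((ideal_norm I)%:R : R) (- s)).

Definition legendre (a p : nat) : int :=
  if (p %| a)%N then 0
  else if [exists x : 'I_p, (x ^ 2 == a %[mod p])%N] then 1 else -1.

Definition squarefree (d : nat) : bool :=
  [forall m : 'I_d.+1, (m ^ 2 %| d)%N ==> (m == 1%N :> nat)].

Definition largest_squarefree_divisor (n : nat) : nat :=
  \max_(d <- divisors n | squarefree d) d.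

Definition sigma (n : nat) : nat := \sum_(d <- divisors n) d.

Definition f_arith (R : realType) (d : nat) : R :=
  d%:R * \prod_(p <- primes d) (1 - p%:R^-1 * (legendre p 3)%:~R).

Definition Ccoef (R : realType) (n m : nat) (lam : 'I_m -> eis)
    (c : 'I_m -> nat) (alpha beta : int) : R :=
  let delta := gcdn n (absz (alpha ^+ 2 + alpha * beta + beta ^+ 2)) in
  let n' := largest_squarefree_divisor n in
  \sum_(d <- divisors n | coprime d delta)
     d%:R ^+ 2 * (f_arith R n / (3 * f_arith R d)) *
     \prod_(p <- primes d) (1 - p%:R ^- 2)
  + 2 / 3 * complex.Re (eisC R (chi lam c (Eis alpha (- beta)))) *
    \sum_(d <- divisors n | (n' %| d)%N)
       d%:R * n%:R * \prod_(p <- primes d) (1 - p%:R ^- 2).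

Definition mx2 (a b c d : int) : 'M[int]_2 :=
  \matrix_(i, j) if i == 0 then (if j == 0 then a else b)
                 else (if j == 0 then c else d).

Definition Tmx : 'M[int]_2 := mx2 1 1 0 1.
Definition Smx : 'M[int]_2 := mx2 0 (-1) 1 0.

Definition Gamma3 : set 'M[int]_2 :=
  [set g | \det g = 1 /\
           forall i j, (g i j = (1%:M : 'M[int]_2) i j %[mod 3])%Z].

Definition T3_coset (g : 'M[int]_2) : set 'M[int]_2 :=
  [set (Tmx ^+ 3) ^ k *m g | k in [set: int]].

Definition T3_quotient : set (set 'M[int]_2) := T3_coset @` Gamma3.

Definition moebius (R : realType) (g : 'M[int]_2) (tau : R[i]) : R[i] :=
  ((g 0 0)%:~R * tau + (g 0 1)%:~R) / ((g 1 0)%:~R * tau + (g 1 1)%:~R).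

(* Each coset K is evaluated at a representative g; the summand does not depend
   on it, since left multiplication by T ^+ 3 preserves the bottom row and the
   imaginary part. *)
Definition Ffun (R : realType) (n m : nat) (lam : 'I_m -> eis)
    (c : 'I_m -> nat) (tau s : R[i]) : R[i] :=
  (2 * pi / (3 * n%:R))%:C *
  csum T3_quotient (fun K =>
    let g := xget 1%:M K in
    (Ccoef R n lam c (g 1 1) (- g 1 0))%:C * cpow (complex.Im (moebius g tau)) s
    - (Ccoef R n lam c (g 1 0) (g 1 1))%:C
        * cpow (complex.Im (moebius (g *m Smx) tau)) s).

(* Main.v *)
(** The coset of a matrix with bottom row (c, d) is recorded by the primitive
    element z = d + c w, which is congruent to 1 modulo 3; then
    Im (g w) = (sqrt 3 / 2) / N(z).  In F(w, s) the first parts of the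
    coefficients C cancel under c -> - c.  The second parts contribute the cubic
    character, and since chi commutes with conjugation and chi(w) is a cube root
    of unity other than 1 (this is n <> +-1 mod 9), the two halves combine into
    B * Lam, where Lam is the sum of chi(z) N(z)^-s over the primitive z = 1 mod 3.
    Every ideal prime to 3n is (g z) for a unique integer g > 0 prime to 3n and a
    unique such z with chi(z) <> 0; as chi(g) = 1, the L-function is Lam times the
    sum of g^(-2s), which is zeta(2s) without the Euler factors at 3n. *)

Require Import Defs.
From HB Require Import structures.
From mathcomp Require Import all_boot all_order all_algebra finmap.
From mathcomp Require Import all_classical all_reals all_analysis.
From mathcomp Require Import showcase.summability.
From mathcomp Require Import complex ring lra zify.

Import Order.TTheory GRing.Theory Num.Theory.
Import numFieldNormedType.Exports.

Local Open Scope ring_scope.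
Local Open Scope complex_scope.
(** * Unordered sums *)

(** [csum] has a value even for a divergent family, so every sum is handled through the relation
    [has_sum] and read as a [csum] only once its limit is known. Limits exist by [abs_bounded], a
    uniform bound on finite absolute sums; their values follow from uniqueness under splitting,
    reindexing and products. The sums over z are majorized by products of one-dimensional sums,
    because N(a + b w) >= |a| |b|. The facts on chi rest on one observation: n is a rational
    integer, so conjugation permutes its prime factors in Z[w] up to units and keeps their
    exponents. Hence chi commutes with conjugation, and chi(g) = 1 for rational g prime to n, as a
    cube root of unity fixed by conjugation. The value chi(w) is a power of w whose exponent modulo
    3 is read off from n^2 modulo 9. *)

Section UnorderedSums.
Set Implicit Arguments.
Unset Strict Implicit.
Local Open Scope classical_set_scope.

Definition has_sum {K : numFieldType} {T : choiceType} (D : set T) (f : T -> K) (l : K) : Prop :=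
  forall e : K, 0 < e -> exists2 A : {fset T}, [set` A] `<=` D &
    forall B : {fset T}, (A `<=` B)%fset -> [set` B] `<=` D ->
      `|\sum_(x <- B) f x - l| < e.

(** Absolute convergence without a limit: this form passes directly to subsets, majorants, injective
    images and products. *)
Definition abs_bounded {K : numFieldType} {T : choiceType} (D : set T) (f : T -> K) : Prop :=
  exists M : K, forall A : {fset T}, [set` A] `<=` D -> \sum_(x <- A) `|f x| <= M.

Lemma fset_setU_sub {T : choiceType} (D : set T) (A B : {fset T}) :
  [set` A] `<=` D -> [set` B] `<=` D -> [set` (A `|` B)%fset] `<=` D.
Proof. by move=> hA hB x /=; rewrite inE => /orP[/hA|/hB]. Qed.

Section NumField.
Variable K : numFieldType.
Implicit Types T : choiceType.

(** The order of a [numFieldType] is partial, so the usual epsilon argument needs both sides to be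
    comparable. *)
Lemma real_ler_addgt0P (x y : K) : x \is Num.real -> y \is Num.real ->
  (forall e, 0 < e -> x <= e + y) -> x <= y.
Proof.
move=> xR yR h; case: (real_leP xR yR) => // yx.
have h2 : 0 < (x - y) / 2 by rewrite divr_gt0// subr_gt0.
have := h _ h2; rewrite -lerBlDr {1}[x - y]splitr gerDl.
by rewrite lt_geF.
Qed.

Lemma has_sum_unique T (D : set T) (f : T -> K) (l l' : K) :
  has_sum D f l -> has_sum D f l' -> l = l'.
Proof.
move=> h h'; apply/eqP; rewrite -subr_eq0 -normr_le0.
apply: real_ler_addgt0P => // e e0; rewrite addr0.
have e2 : 0 < e / 2 by rewrite divr_gt0.
have [A hA1 hA2] := h _ e2; have [B hB1 hB2] := h' _ e2.
have hAB := @fset_setU_sub _ _ _ _ hA1 hB1.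
have h1 := hA2 _ (fsubsetUl A B) hAB; have h2 := hB2 _ (fsubsetUr A B) hAB.
rewrite [e]splitr (le_trans (ler_distD (\sum_(x <- (A `|` B)%fset) f x) _ _))//.
by rewrite distrC ltW// ltrD.
Qed.

Lemma eq_has_sum T (D : set T) (f g : T -> K) (l : K) :
  (forall x, D x -> f x = g x) -> has_sum D f l -> has_sum D g l.
Proof.
move=> fg h e /h [A hA1 hA2]; exists A => // B hAB hB.
rewrite (_ : \sum_(x <- B) g x = \sum_(x <- B) f x) ?hA2//.
by rewrite big_seq [RHS]big_seq; apply: eq_bigr => x xB; rewrite fg//; exact: hB.
Qed.

Lemma has_sumD T (D : set T) (f g : T -> K) (l l' : K) :
  has_sum D f l -> has_sum D g l' -> has_sum D (fun x => f x + g x) (l + l').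
Proof.
move=> h h' e e0; have e2 : 0 < e / 2 by rewrite divr_gt0.
have [A hA1 hA2] := h _ e2; have [B hB1 hB2] := h' _ e2.
exists (A `|` B)%fset; first exact: fset_setU_sub.
move=> C; rewrite fsubUset => /andP[hAC hBC] hC.
rewrite big_split/= opprD addrACA (le_lt_trans (ler_normD _ _))//.
by rewrite [e]splitr ltrD// ?hA2// hB2.
Qed.

Lemma has_sumZ T (D : set T) (f : T -> K) (l c : K) :
  has_sum D f l -> has_sum D (fun x => c * f x) (c * l).
Proof.
(* Dividing by [|c| + 1] rather than [|c|] covers c = 0. *)
move=> h e e0; have c1 : 0 < `|c| + 1 by rewrite ltr_wpDl.
have [|A hA1 hA2] := h (e / (`|c| + 1)); first by rewrite divr_gt0.
exists A => // B hAB hB; rewrite -mulr_sumr -mulrBr normrM.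
have := hA2 _ hAB hB; rewrite ltr_pdivlMr// mulrC => hlt.
by apply: le_lt_trans hlt; rewrite ler_wpM2r// lerDl.
Qed.

Lemma has_sum_fin_near T (D : set T) (f : T -> K) (l : K) (C : {fset T}) (e : K) :
  [set` C] `<=` D -> has_sum D f l -> 0 < e ->
  exists B : {fset T}, [/\ (C `<=` B)%fset, [set` B] `<=` D & `|\sum_(x <- B) f x - l| < e].
Proof.
move=> hC h e0; have [A hA1 hA2] := h _ e0.
exists (A `|` C)%fset; split; [exact: fsubsetUr|exact: fset_setU_sub|].
by apply: hA2; [exact: fsubsetUl|exact: fset_setU_sub].
Qed.

Lemma has_sumU T (D D' : set T) (f : T -> K) (l l' : K) :
  (forall x, D x -> D' x -> False) ->
  has_sum D f l -> has_sum D' f l' -> has_sum (D `|` D') f (l + l').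
Proof.
move=> dis h h' e e0; have e2 : 0 < e / 2 by rewrite divr_gt0.
have [A hA1 hA2] := h _ e2; have [B hB1 hB2] := h' _ e2.
exists (A `|` B)%fset.
  by move=> x /=; rewrite inE => /orP[/hA1|/hB1]; [left|right].
move=> C; rewrite fsubUset => /andP[hAC hBC] hC.
have -> : \sum_(x <- C) f x = \sum_(x <- [fset x in C | `[< D x >]]%fset) f x
   + \sum_(x <- [fset x in C | `[< D' x >]]%fset) f x.
  rewrite (bigID (fun x => `[< D x >]))/= !big_fset/=; congr (_ + _).
  rewrite big_seq_cond [RHS]big_seq_cond; apply: eq_bigl => x.
  case xC : (x \in C) => //=; have /= := hC x xC.
  move=> [Dx|Dx].
    rewrite (asboolT Dx)/=; symmetry; apply/negbTE/asboolPn => D'x; exact: dis Dx D'x.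
  rewrite (asboolT Dx)/=; apply/asboolPn => D'x; exact: dis D'x Dx.
rewrite opprD addrACA (le_lt_trans (ler_normD _ _))// [e]splitr ltrD//.
  apply: hA2; last by move=> x /=; rewrite !inE/= => /andP[_ /asboolP].
  by apply/fsubsetP => x xA; rewrite !inE/= (fsubsetP hAC)//=; apply/asboolP/hA1.
apply: hB2; last by move=> x /=; rewrite !inE/= => /andP[_ /asboolP].
by apply/fsubsetP => x xA; rewrite !inE/= (fsubsetP hBC)//=; apply/asboolP/hB1.
Qed.

Lemma mem_fset_of_seq T (s : seq T) x : (x \in [fset y in s]%fset) = (x \in s).
Proof. by rewrite inE. Qed.

Lemma big_fset_of_seq T (s : seq T) (f : T -> K) :
  uniq s -> \sum_(x <- [fset x in s]%fset) f x = \sum_(x <- s) f x.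
Proof.
move=> us; apply: perm_big; apply: uniq_perm => //.
by move=> x; rewrite inE.
Qed.

Lemma big_fset_pairs T T' (A : {fset T}) (B : {fset T'}) (h : T * T' -> K) :
  \sum_(z <- [fset z in [seq (x, y) | x <- A, y <- B]]%fset) h z =
  \sum_(x <- A) \sum_(y <- B) h (x, y).
Proof.
rewrite big_fset_of_seq ?big_allpairs//.
by apply: allpairs_uniq => // -[? ?] [? ?].
Qed.

(** The image of [e] may miss points of [D'] as long as [f'] vanishes there. The equivalence thus
    serves both as a change of variables and, right to left with [e] the identity, as a restriction
    to the support. *)
Lemma has_sum_reindex T T' (D : set T) (D' : set T') (e : T -> T')
    (f : T -> K) (f' : T' -> K) (l : K) :
  (forall x, D x -> D' (e x)) ->
  (forall x y, D x -> D y -> e x = e y -> x = y) ->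
  (forall x, D x -> f' (e x) = f x) ->
  (forall y, D' y -> ~ (exists2 x, D x & e x = y) -> f' y = 0) ->
  has_sum D f l <-> has_sum D' f' l.
Proof.
move=> eD einj ef f0.
(* A partial inverse of [e]: points outside the image go to [None], so [pmap g] drops only terms
   equal to 0. *)
have /choice[g gP] : forall y, exists o : option T,
    if o is Some x then D x /\ e x = y else ~ (exists2 x, D x & e x = y).
  move=> y; case: (pselect (exists2 x, D x & e x = y)) => [[x ? ?]|h].
    by exists (Some x).
  by exists None.
have ge x : D x -> g (e x) = Some x.
  move=> Dx; have := gP (e x); case: (g (e x)) => [x' [Dx' /einj -> //]|].
  by case; exists x.
have gmem y x : g y = Some x -> D x /\ e x = y by move=> h; have := gP y; rewrite h.
pose pre (B : seq T') := pmap g B.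
have mpre (B : seq T') x : x \in pre B <-> D x /\ e x \in B.
  rewrite mem_pmap; split.
    move=> /mapP[y yB /esym /gmem [Dx ex]]; by rewrite ex.
  by move=> [Dx exB]; rewrite -(ge x Dx) map_f.
have upre (B : {fset T'}) : uniq (pre B).
  have -> : pre B = pmap g B by [].
  elim: (B : seq T') (fset_uniq B) => //= y s IH /andP[ys us].
  case gy : (g y) => [x|] /=; last exact: IH.
  rewrite IH// andbT; apply/negP => /mpre [Dx].
  by have [_ ->] := gmem _ _ gy; rewrite (negbTE ys).
have spre (B : {fset T'}) : [set` B] `<=` D' -> \sum_(y <- B) f' y = \sum_(x <- pre B) f x.
  have -> : pre B = pmap g B by [].
  move=> hB; have {hB} : forall y, y \in (B : seq T') -> D' y by move=> y yB; exact: hB.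
  elim: (B : seq T') => [|y s IH] hs; first by rewrite !big_nil.
  rewrite big_cons/= IH; last by move=> z zs; apply: hs; rewrite inE zs orbT.
  have := gP y; case gy : (g y) => [x|]/=.
    by move=> [Dx <-]; rewrite ef// big_cons.
  by move=> ny; rewrite f0 ?add0r//; apply: hs; rewrite inE eqxx.
split=> h eps eps0; have [A hA1 hA2] := h _ eps0.
- exists [fset e x | x in A]%fset.
    by move=> y /= /imfsetP[x /= /hA1 Dx ->]; exact: eD.
  move=> B hAB hB; rewrite spre// -big_fset_of_seq//; apply: hA2.
    apply/fsubsetP => x xA; rewrite inE/=; apply/mpre; split; first exact: hA1.
    by apply: (fsubsetP hAB); apply/imfsetP; exists x.
  by move=> x /=; rewrite inE/= => /mpre[].
- exists [fset x in pre A]%fset.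
    by move=> x /=; rewrite inE/= => /mpre[].
  move=> B hAB hB.
  (* Adjoining the image of [B] to [A] gives a finite set that contains [A] and whose preimage is
     exactly [B]. *)
  have hB' : [set` (A `|` [fset e x | x in B])%fset] `<=` D'.
    apply: fset_setU_sub => // y /= /imfsetP[x /= /hB Dx ->]; exact: eD.
  have := hA2 _ (fsubsetUl A [fset e x | x in B]%fset) hB'.
  rewrite spre//; rewrite (_ : \sum_(x <- B) f x = \sum_(x <- pre (A `|` [fset e x | x in B])%fset) f x)//.
  apply: perm_big; apply: uniq_perm; rewrite ?fset_uniq//.
  move=> x; apply/idP/idP.
    move=> xB; apply/mpre; split; first exact: hB.
    by rewrite inE; apply/orP; right; apply/imfsetP; exists x.
  move=> /mpre[Dx]; rewrite inE => /orP[exA|/imfsetP[x' /= x'B /einj ->]//].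
    by apply: (fsubsetP hAB); rewrite inE/=; apply/mpre.
  exact: hB.
Qed.

Lemma abs_bounded_subset T (D D' : set T) (f : T -> K) :
  D `<=` D' -> abs_bounded D' f -> abs_bounded D f.
Proof. by move=> DD' [M h]; exists M => A hA; apply: h => x /hA /DD'. Qed.

Lemma abs_bounded_le T (D : set T) (f g : T -> K) (c : K) : 0 <= c ->
  (forall x, D x -> `|f x| <= c * `|g x|) -> abs_bounded D g -> abs_bounded D f.
Proof.
move=> c0 fg [M h]; exists (c * M) => A hA.
apply: le_trans (ler_wpM2l c0 (h _ hA)); rewrite mulr_sumr big_seq [leRHS]big_seq.
by apply: ler_sum => x xA; apply: fg; exact: hA.
Qed.

Lemma abs_bounded_inj T T' (D : set T) (D' : set T') (e : T -> T') (f : T' -> K) :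
  (forall x, D x -> D' (e x)) ->
  (forall x y, D x -> D y -> e x = e y -> x = y) ->
  abs_bounded D' f -> abs_bounded D (fun x => f (e x)).
Proof.
move=> eD einj [M h]; exists M => A hA.
have hA' : [set` [fset e x | x in A]%fset] `<=` D'.
  by move=> y /= /imfsetP[x /= /hA Dx ->]; exact: eD.
have := h _ hA'; rewrite big_imfset//= => x y xA yA; apply: einj; exact: hA.
Qed.

Lemma abs_bounded_surj T T' (D : set T) (D' : set T') (g : T' -> T) (f : T -> K) (f' : T' -> K) :
  (forall y, D' y -> D (g y)) ->
  (forall y z, D' y -> D' z -> g y = g z -> y = z) ->
  (forall y, D' y -> f (g y) = f' y) ->
  abs_bounded D f -> abs_bounded D' f'.
Proof.
move=> gD ginj fg h; have [M h'] := @abs_bounded_inj _ _ _ _ _ _ gD ginj h; exists M => A hA.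
rewrite (_ : \sum_(x <- A) `|f' x| = \sum_(x <- A) `|f (g x)|); first exact: h'.
by rewrite big_seq [RHS]big_seq; apply: eq_bigr => y yA; rewrite fg//; exact: hA.
Qed.

Lemma ler_sum_fsubset T (A B : {fset T}) (f : T -> K) :
  (A `<=` B)%fset -> (forall x, 0 <= f x) -> \sum_(x <- A) f x <= \sum_(x <- B) f x.
Proof.
move=> AB f0; rewrite [leRHS](big_fsetID _ (mem A))/=.
rewrite [X in _ <= X + _](_ : _ = \sum_(x <- A) f x).
  by rewrite lerDl; apply: sumr_ge0.
apply: perm_big; apply: uniq_perm; rewrite ?fset_uniq//.
by move=> x; rewrite !inE/= andbC; case xA : (x \in A) => //=; apply: (fsubsetP AB).
Qed.

(** A finite subset of the product lies in the rectangle spanned by its two projections, and the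
    absolute sum over a rectangle factors. *)
Lemma abs_bounded_prod T T' (D : set T) (D' : set T') (f : T -> K) (g : T' -> K) :
  abs_bounded D f -> abs_bounded D' g ->
  abs_bounded (D `*` D') (fun z => f z.1 * g z.2).
Proof.
move=> [M hM] [N hN]; exists (M * N) => A hA.
pose A1 := [fset z.1 | z in A]%fset; pose A2 := [fset z.2 | z in A]%fset.
have hA1 : [set` A1] `<=` D by move=> x /= /imfsetP[z /= /hA [? ?] ->].
have hA2 : [set` A2] `<=` D' by move=> x /= /imfsetP[z /= /hA [? ?] ->].
have h1 := hM _ hA1; have h2 := hN _ hA2.
apply: le_trans (_ : (\sum_(x <- A1) `|f x|) * (\sum_(y <- A2) `|g y|) <= _); last first.
  by apply: ler_pM => //; apply: sumr_ge0.
rewrite mulr_suml (eq_bigr (fun x => \sum_(y <- A2) `|f x * g y|)); last first.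
  by move=> x _; rewrite mulr_sumr; apply: eq_bigr => y _; rewrite normrM.
rewrite -(@big_fset_pairs _ _ _ _ (fun z => `|f z.1 * g z.2|)).
apply: ler_sum_fsubset => //; apply/fsubsetP => z zA; rewrite inE/=.
apply/allpairsP; exists z; split; last by case: z zA.
  by apply/imfsetP; exists z.
by apply/imfsetP; exists z.
Qed.

Lemma abs_boundedU T (D D' : set T) (f : T -> K) :
  abs_bounded D f -> abs_bounded D' f -> abs_bounded (D `|` D') f.
Proof.
move=> [M hM] [N hN]; exists (M + N) => A hA.
rewrite (bigID (fun x => `[< D x >]))/=; apply: lerD.
  have := hM [fset x in A | `[< D x >]]%fset; rewrite big_fset/=; apply.
  by move=> x /=; rewrite !inE/= => /andP[_ /asboolP].
have := hN [fset x in A | ~~ `[< D x >]]%fset; rewrite big_fset/=; apply.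
by move=> x /=; rewrite !inE/= => /andP[/hA [|//] Dx /asboolPn].
Qed.

(** Meant for nonvanishing: a term that outweighs all the others together keeps the sum away from
    0. *)
Lemma has_sum_dist_le T (D : set T) (f : T -> K) (l M : K) (x0 : T) : D x0 ->
  has_sum D f l ->
  (forall A : {fset T}, [set` A] `<=` D -> x0 \notin A -> \sum_(x <- A) `|f x| <= M) ->
  `|l - f x0| <= M.
Proof.
move=> Dx0 h hM; have M0 : M \is Num.real.
  apply: ger0_real; have := hM fset0; rewrite big_nil; apply=> //.
apply: real_ler_addgt0P => // e e0.
have [|B [hB1 hB2 hB3]] := @has_sum_fin_near _ D f l [fset x0]%fset e _ h e0.
  by move=> x /=; rewrite inE => /eqP ->.
have x0B : x0 \in B by apply: (fsubsetP hB1); rewrite inE.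
rewrite (le_trans (ler_distD (\sum_(x <- B) f x) _ _))//; apply: lerD.
  by rewrite distrC ltW.
rewrite (big_fsetD1 x0)//= addrAC subrr add0r (le_trans (ler_norm_sum _ _ _))//.
apply: hM; last by rewrite !inE eqxx.
by move=> x /=; rewrite !inE => /andP[_ /hB2].
Qed.

(* A rectangle containing a finite set close to the limit of the double sum
   factors, so its sum is also close to the product of the limits. *)
Lemma has_sumM T T' (D : set T) (D' : set T') (f : T -> K) (g : T' -> K) (a b l : K) :
  has_sum D f a -> has_sum D' g b ->
  has_sum (D `*` D') (fun z => f z.1 * g z.2) l -> l = a * b.
Proof.
move=> hf hg h; apply/eqP; rewrite -subr_eq0 -normr_le0.
apply: real_ler_addgt0P => // e e0; rewrite addr0.
pose c := `|a| + `|b| + 1.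
have c0 : 0 < c by rewrite ltr_wpDl// addr_ge0.
(* As d < 1, the cross term (sA - a)(sB - b) is at most d, so the product is off by at most d (1 +
   |a| + |b|) = d c <= e / 2. *)
pose d := e / 2 / (c + e).
have ce0 : 0 < c + e by rewrite addr_gt0.
have d0 : 0 < d by rewrite !divr_gt0.
have de : d < 1.
  rewrite /d ltr_pdivrMr// mul1r ltr_wpDl//; first exact: ltW.
  by rewrite ltr_pdivrMr// mulr2n mulrDr mulr1 ltrDl.
have e20 : 0 < e / 2 by rewrite divr_gt0.
have [C hC1 hC2] := h _ e20.
have [|A [hA1 hA2 hA3]] := @has_sum_fin_near _ D f a [fset z.1 | z in C]%fset d _ hf d0.
  by move=> x /= /imfsetP[z /= /hC1 [? ?] ->].
have [|B [hB1 hB2 hB3]] := @has_sum_fin_near _ D' g b [fset z.2 | z in C]%fset d _ hg d0.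
  by move=> x /= /imfsetP[z /= /hC1 [? ?] ->].
pose AB := [fset z in [seq (x, y) | x <- A, y <- B]]%fset.
have hCAB : (C `<=` AB)%fset.
  apply/fsubsetP => z zC; rewrite inE/=; apply/allpairsP; exists z.
  split; last by case: (z).
    by apply: (fsubsetP hA1); apply/imfsetP; exists z.
  by apply: (fsubsetP hB1); apply/imfsetP; exists z.
have hAB : [set` AB] `<=` D `*` D'.
  by move=> z /=; rewrite inE/= => /allpairsP[[x y] [/hA2 ? /hB2 ? ->]].
have := hC2 _ hCAB hAB.
rewrite big_fset_pairs (eq_bigr (fun x => f x * \sum_(y <- B) g y)) /=; last first.
  by move=> x _; rewrite mulr_sumr.
rewrite -mulr_suml; move: hA3 hB3; set sA := \sum_(x <- A) _; set sB := \sum_(x <- B) _.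
move=> hA3 hB3 h3.
rewrite (le_trans (ler_distD (sA * sB) _ _))// [e]splitr; apply: lerD.
  by rewrite distrC ltW.
have -> : sA * sB - a * b = (sA - a) * (sB - b) + (sA - a) * b + a * (sB - b) by ring.
rewrite (le_trans (ler_normD _ _))//.
have h1 : `|(sA - a) * (sB - b) + (sA - a) * b| <= d * 1 + d * `|b|.
  rewrite (le_trans (ler_normD _ _))// !normrM; apply: lerD.
    by apply: ler_pM => //; apply: ltW => //; exact: lt_trans de.
  by apply: ler_wpM2r => //; apply: ltW.
have h2 : `|a * (sB - b)| <= d * `|a|.
  by rewrite normrM mulrC; apply: ler_wpM2r => //; exact: ltW.
rewrite (le_trans (lerD h1 h2))// -!mulrDr.
rewrite (_ : 1 + `|b| + `|a| = c); last by rewrite /c; ring.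
by rewrite /d mulrAC ler_pdivrMr// ler_pM2l// lerDl ltW.
Qed.

End NumField.

(** The net of partial sums is increasing, so it converges to its supremum. *)
Lemma has_sum_ge0 (R : realType) (T : choiceType) (D : set T) (f : T -> R) :
  (forall x, 0 <= f x) -> abs_bounded D f -> exists l, has_sum D f l.
Proof.
move=> f0 [M hM].
pose E := [set y | exists2 A : {fset T}, [set` A] `<=` D & y = \sum_(x <- A) f x].
have hE : has_sup E.
  split; first by exists 0; exists fset0; rewrite ?big_nil//= => x; rewrite inE.
  exists M => y [A hA ->]; apply: le_trans (hM _ hA); apply: ler_sum => x _.
  exact: ler_norm.
exists (sup E) => e e0.
have [y [A hA ->] hy] := sup_adherent e0 hE.
exists A => // B hAB hB.
have hB' : \sum_(x <- B) f x <= sup E by apply: sup_ubound; [case: hE|exists B].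
rewrite distrC ger0_norm ?subr_ge0// ltrBlDl -ltrBlDr.
by apply: (lt_le_trans hy); exact: ler_sum_fsubset.
Qed.

(** Both f + |f| and |f| are nonnegative, and f is their difference. *)
Lemma has_sum_real (R : realType) (T : choiceType) (D : set T) (f : T -> R) :
  abs_bounded D f -> exists l, has_sum D f l.
Proof.
move=> hf.
have [||l1 h1] := @has_sum_ge0 R T D (fun x => `|f x|) => //.
  by case: hf => M hM; exists M => A hA; under eq_bigr do rewrite normr_id; exact: hM.
have [||l2 h2] := @has_sum_ge0 R T D (fun x => f x + `|f x|) => //.
- by move=> x; rewrite -lerBlDl sub0r -normrN ler_norm.
- case: hf => M hM; exists (M + M) => A hA.
  rewrite (le_trans _ (lerD (hM _ hA) (hM _ hA)))// -big_split/=; apply: ler_sum => x _.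
  by rewrite (le_trans (ler_normD _ _))// normr_id.
exists (l2 + -1 * l1).
apply: eq_has_sum (has_sumD h2 (has_sumZ (-1) h1)).
by move=> x _; rewrite mulN1r addrK.
Qed.

(** Real and imaginary parts are dominated by the modulus. A positive element of [R[i]] is real,
    which lets the real limits be lifted with the same [e]. *)
Lemma has_sum_complex (R : realType) (T : choiceType) (D : set T) (f : T -> R[i]) :
  abs_bounded D f -> exists l, has_sum D f l.
Proof.
move=> [M hM].
have M0 : 0 <= M by have := hM fset0; rewrite big_nil; apply => x /=; rewrite inE.
have part (h : R[i] -> R) : (forall z, `|h z|%:C <= `|z|) -> abs_bounded D (fun x => h (f x)).
  move=> hz; exists (complex.Re M) => A hA.
  have := hM _ hA; rewrite lecE => /andP[_]; apply: le_trans.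
  have : (\sum_(x <- A) `|h (f x)|)%:C <= \sum_(x <- A) `|f x|.
    by rewrite rmorph_sum/=; apply: ler_sum => x _; exact: hz.
  by rewrite lecE => /andP[_].
have normc_ge_Im (z : R[i]) : `|complex.Im z|%:C <= `|z|.
  by rewrite normc_def lecR -sqrtr_sqr ler_wsqrtr// lerDr sqr_ge0.
have [a ha] := has_sum_real (part (@complex.Re R) (@normc_ge_Re R)).
have [b hb] := has_sum_real (part (@complex.Im R) normc_ge_Im).
have lift (h : T -> R) l : has_sum D h l -> has_sum D (fun x => (h x)%:C) l%:C.
  move=> hh e; rewrite lt_def => /andP[e0]; rewrite lecE /= => /andP[/eqP eI eR].
  have eE : e = (complex.Re e)%:C by case: (e) eI => /= x y ->.
  have [|A hA1 hA2] := hh (complex.Re e).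
    by rewrite lt_def eR andbT; apply: contra e0 => /eqP e0; rewrite eE e0.
  exists A => // B hAB hB; rewrite -rmorph_sum -rmorphB/= eE.
  by rewrite normc_def/= expr0n/= addr0 sqrtr_sqr ltcR; exact: hA2.
exists (a%:C + 'i * b%:C).
apply: eq_has_sum (has_sumD (lift _ _ ha) (has_sumZ 'i (lift _ _ hb))).
by move=> x _ /=; rewrite [RHS]complexE.
Qed.

(** The library sums over the subtype of [D]: its finite sets map to [T] by [val], and finite
    subsets of [D] come back by [insub]. Separation makes the limit unique. *)
Lemma csum_has_sum (R : realType) (T : choiceType) (D : set T) (f : T -> R[i]) (l : R[i]) :
  has_sum D f l -> csum D f = l.
Proof.
move=> h; have hK : hausdorff_space R[i]^o := @norm_hausdorff _ R[i]^o.
apply: (cvg_lim hK (FF := totally_filter)).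
have FF := @totally_filter {x : T | x \in D}.
apply/fcvgrPdist_lt => e e0.
have [A hA1 hA2] := h _ e0.
pose A' : {fset D} := [fset x in pmap insub A]%fset.
exists A' => // B /= hAB.
rewrite distrC /partial_sum.
have -> : \sum_(i : B) f (val (val i)) = \sum_(x <- [fset val x | x in B]%fset) f x.
  rewrite big_imfset/=; last by move=> x y _ _ /val_inj.
  by rewrite big_seq_fsetE.
apply: hA2.
  apply/fsubsetP => x xA; apply/imfsetP; exists (Sub x (mem_set (hA1 _ xA))) => //=.
  apply: (fsubsetP hAB); rewrite inE/= mem_pmap; apply/mapP; exists x => //.
  by rewrite insubT ?mem_set//; [exact: hA1|move=> ?; congr Some; exact: val_inj].
by move=> y /= /imfsetP[x _ ->]; apply: set_mem; exact: valP.
Qed.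

End UnorderedSums.

(** * Arithmetic of the Eisenstein integers *)

Section EisensteinArithmetic.
Set Implicit Arguments.
Unset Strict Implicit.
Implicit Types (x y z w : eis).

(** The conjugate of w is - 1 - w. *)
Definition eis_conj z : eis := Eis (eis_re z - eis_om z) (- eis_om z).
Definition eis_w : eis := Eis 0 1.
(** The norm with values in [int], where [ring] and [nia] apply. *)
Definition enorm z : int := eis_re z ^+ 2 - eis_re z * eis_om z + eis_om z ^+ 2.

Lemma eis_ext x y : eis_re x = eis_re y -> eis_om x = eis_om y -> x = y.
Proof. by case: x y => [? ?] [? ?] /= -> ->. Qed.

Lemma eis_reM x y : eis_re (x * y) = eis_re x * eis_re y - eis_om x * eis_om y.
Proof. by []. Qed.
Lemma eis_omM x y :
  eis_om (x * y) = eis_re x * eis_om y + eis_om x * eis_re y - eis_om x * eis_om y.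
Proof. by []. Qed.
Lemma eis_reD x y : eis_re (x + y) = eis_re x + eis_re y. Proof. by []. Qed.
Lemma eis_omD x y : eis_om (x + y) = eis_om x + eis_om y. Proof. by []. Qed.
Lemma eis_reN x : eis_re (- x) = - eis_re x. Proof. by []. Qed.
Lemma eis_omN x : eis_om (- x) = - eis_om x. Proof. by []. Qed.

Lemma eis_nat (k : nat) : k%:R = Eis k 0.
Proof. by elim: k => // k IH; rewrite -natr1 IH; apply: eis_ext => //=; lia. Qed.

Lemma eis_int (k : int) : k%:~R = Eis k 0.
Proof.
by case: k => k; rewrite ?NegzE ?mulrNz -pmulrn eis_nat.
Qed.

Definition eisE := (eis_reM, eis_omM, eis_reD, eis_omD, eis_reN, eis_omN, eis_nat, eis_int).

(** Completing the square shows that the norm form is positive definite. *)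
Lemma enorm_mul4 z : 4 * enorm z = (2 * eis_re z - eis_om z) ^+ 2 + 3 * eis_om z ^+ 2.
Proof. by rewrite /enorm; ring. Qed.

Lemma enorm_ge0 z : 0 <= enorm z.
Proof. by have := enorm_mul4 z; nia. Qed.

Lemma enorm_eq0 z : enorm z = 0 -> z = 0.
Proof.
move=> h; have := enorm_mul4 z; rewrite h mulr0 => h4.
have o0 : eis_om z = 0 by nia.
by apply: eis_ext => //=; move: h4; rewrite o0; nia.
Qed.

Lemma eis_normE z : (eis_norm z)%:Z = enorm z.
Proof. by rewrite /eis_norm gez0_abs// enorm_ge0. Qed.

Lemma enormM x y : enorm (x * y) = enorm x * enorm y.
Proof. by rewrite /enorm !eisE; ring. Qed.

Lemma eis_normM x y : eis_norm (x * y) = (eis_norm x * eis_norm y)%N.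
Proof. by apply/eqP; rewrite -eqz_nat PoszM !eis_normE enormM. Qed.

Lemma eis_norm_gt0 z : z <> 0 -> (0 < eis_norm z)%N.
Proof.
by move=> z0; rewrite lt0n; apply/eqP => h; apply: z0; apply: enorm_eq0; rewrite -eis_normE h.
Qed.

Lemma eis_norm0 : eis_norm 0 = 0%N. Proof. by []. Qed.
Lemma eis_norm1 : eis_norm 1 = 1%N. Proof. by []. Qed.

Lemma eis_norm_nat (k : nat) : eis_norm k%:R = (k ^ 2)%N.
Proof. by apply/eqP; rewrite -eqz_nat eis_normE eis_nat /enorm/=; lia. Qed.

Lemma eis_normX z k : eis_norm (z ^+ k) = (eis_norm z ^ k)%N.
Proof. by elim: k => // k IH; rewrite exprS expnS eis_normM IH. Qed.

Lemma eis_norm_prod (I : Type) (r : seq I) (P : pred I) (F : I -> eis) :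
  eis_norm (\prod_(i <- r | P i) F i) = (\prod_(i <- r | P i) eis_norm (F i))%N.
Proof. by apply: (big_morph eis_norm) => // x y; exact: eis_normM. Qed.

Lemma eis_mul_eq0 x y : x * y = 0 -> x = 0 \/ y = 0.
Proof.
move=> /(congr1 eis_norm); rewrite eis_normM eis_norm0 => /eqP; rewrite muln_eq0.
move=> /orP[] /eqP h; [left|right]; apply: enorm_eq0; by rewrite -eis_normE h.
Qed.

Lemma eis_mulI x y z : x <> 0 -> x * y = x * z -> y = z.
Proof.
move=> x0 h; have /eis_mul_eq0[//|/eqP] : x * (y - z) = 0 by rewrite mulrBr h subrr.
by rewrite subr_eq0 => /eqP.
Qed.

Lemma eis_conjK : involutive eis_conj.
Proof. by move=> z; apply: eis_ext => /=; ring. Qed.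
Lemma eis_conjM x y : eis_conj (x * y) = eis_conj x * eis_conj y.
Proof. by apply: eis_ext; rewrite /= ?eisE/=; ring. Qed.
Lemma eis_conjD x y : eis_conj (x + y) = eis_conj x + eis_conj y.
Proof. by apply: eis_ext; rewrite /= ?eisE/=; ring. Qed.
Lemma eis_conjN x : eis_conj (- x) = - eis_conj x.
Proof. by apply: eis_ext; rewrite /= ?eisE/=; ring. Qed.
Lemma eis_conj_nat (k : nat) : eis_conj k%:R = k%:R.
Proof. by rewrite eis_nat; apply: eis_ext => /=; ring. Qed.
Lemma eis_conjX z k : eis_conj (z ^+ k) = eis_conj z ^+ k.
Proof. by elim: k => [|k IH]; [exact: (eis_conj_nat 1)|rewrite !exprS eis_conjM IH]. Qed.
Lemma eis_conj_prod (I : Type) (r : seq I) (P : pred I) (F : I -> eis) :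
  eis_conj (\prod_(i <- r | P i) F i) = \prod_(i <- r | P i) eis_conj (F i).
Proof. by apply: (big_morph eis_conj) => //; exact: eis_conjM. Qed.
Lemma eis_norm_conj z : eis_norm (eis_conj z) = eis_norm z.
Proof. by congr absz; rewrite /=; ring. Qed.
Lemma eis_mul_conj z : z * eis_conj z = (eis_norm z)%:R.
Proof.
by rewrite eis_nat eis_normE; apply: eis_ext; rewrite !eisE /enorm/=; ring.
Qed.

Lemma eis_dvd_refl x : eis_dvd x x.
Proof. by exists 1; rewrite mul1r. Qed.
Lemma eis_dvd0 x : eis_dvd x 0.
Proof. by exists 0; rewrite mul0r. Qed.
Lemma eis_dvdD d x y : eis_dvd d x -> eis_dvd d y -> eis_dvd d (x + y).
Proof. by move=> [a ->] [b ->]; exists (a + b); rewrite mulrDl. Qed.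
Lemma eis_dvdN d x : eis_dvd d x -> eis_dvd d (- x).
Proof. by move=> [a ->]; exists (- a); rewrite mulNr. Qed.
Lemma eis_dvdB d x y : eis_dvd d x -> eis_dvd d y -> eis_dvd d (x - y).
Proof. by move=> ? ?; apply: eis_dvdD => //; exact: eis_dvdN. Qed.
Lemma eis_dvdMl d x y : eis_dvd d x -> eis_dvd d (y * x).
Proof. by move=> [a ->]; exists (y * a); rewrite mulrA. Qed.
Lemma eis_dvdMr d x y : eis_dvd d x -> eis_dvd d (x * y).
Proof. by rewrite mulrC; exact: eis_dvdMl. Qed.
Lemma eis_dvd_trans x y z : eis_dvd x y -> eis_dvd y z -> eis_dvd x z.
Proof. by move=> [a ->] [b ->]; exists (b * a); rewrite mulrA. Qed.
Lemma eis_dvd_conj d x : eis_dvd d x -> eis_dvd (eis_conj d) (eis_conj x).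
Proof. by move=> [a ->]; exists (eis_conj a); rewrite eis_conjM. Qed.
Lemma eis_dvd_sym d x y : eis_dvd d (x - y) -> eis_dvd d (y - x).
Proof. by move=> h; rewrite -opprB; exact: eis_dvdN. Qed.

Lemma eis_dvd_mulB d x y x' y' :
  eis_dvd d (x - x') -> eis_dvd d (y - y') -> eis_dvd d (x * y - x' * y').
Proof.
move=> h h'; have -> : x * y - x' * y' = (x - x') * y + x' * (y - y') by ring.
by apply: eis_dvdD; [exact: eis_dvdMr|exact: eis_dvdMl].
Qed.

Lemma eis_dvd_norm x y : eis_dvd x y -> (eis_norm x %| eis_norm y)%N.
Proof. by move=> [a ->]; rewrite eis_normM dvdn_mull. Qed.

Lemma eis_norm_unit z : eis_norm z = 1%N -> z * eis_conj z = 1.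
Proof. by move=> h; rewrite eis_mul_conj h. Qed.

Lemma eis_dvd_nat (k : nat) z :
  eis_dvd k%:R z <-> (k %| eis_re z)%Z /\ (k %| eis_om z)%Z.
Proof.
rewrite eis_nat; split.
  by move=> [w ->]; rewrite !eisE /= !mulr0 !subr0 add0r; split; apply: dvdz_mull.
move=> [/dvdzP[a ha] /dvdzP[b hb]]; exists (Eis a b).
by apply: eis_ext; rewrite !eisE/= ?ha ?hb; ring.
Qed.

Lemma eis_content z : z <> 0 ->
  exists g : nat, exists z0, [/\ (0 < g)%N, z = g%:R * z0 & coprimez (eis_re z0) (eis_om z0)].
Proof.
move=> z0; have [g gE] : exists g : nat, g%:Z = gcdz (eis_re z) (eis_om z).
  by exists `|gcdz (eis_re z) (eis_om z)|%N.
have g0 : (0 < g)%N.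
  rewrite lt0n -eqz_nat gE gcdz_eq0; apply/negP => /andP[/eqP a0 /eqP b0].
  by apply: z0; apply: eis_ext.
have /dvdzP[a ha] := dvdz_gcdl (eis_re z) (eis_om z).
have /dvdzP[b hb] := dvdz_gcdr (eis_re z) (eis_om z).
rewrite -gE in ha hb; exists g, (Eis a b); split => //.
  by apply: eis_ext; rewrite eis_nat ?eis_reM ?eis_omM/= ?ha ?hb; ring.
have gne : g%:Z != 0 by rewrite eqz_nat -lt0n.
rewrite /coprimez/=; have := gE; rewrite ha hb -mulz_gcdl.
by rewrite -{1}[g%:Z]mul1r => /(mulIf gne) <-.
Qed.

Definition int_mod (k : nat) (v : int) : 'I_k.+1 := inord `|(v %% k.+1)%Z|%N.

Lemma int_mod_eq (k : nat) (u v : int) : int_mod k u = int_mod k v <-> (k.+1 %| v - u)%Z.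
Proof.
have lt (w : int) : (`|(w %% k.+1)%Z| < k.+1)%N.
  by have := @ltz_pmod w k.+1 isT; have := @modz_ge0 w k.+1 isT; lia.
have ge (w : int) : (w %% k.+1)%Z = `|(w %% k.+1)%Z|%N by rewrite gez0_abs// modz_ge0.
rewrite -eqz_mod_dvd; split.
  move=> /(congr1 val); rewrite /int_mod /= !inordK// => h.
  by rewrite /= eq_sym ge h -ge.
by move=> /eqP h; rewrite /int_mod h.
Qed.

Lemma int_mod_ord k (i : 'I_k.+1) : int_mod k i = i.
Proof. by apply/val_inj; rewrite /int_mod /= modz_nat absz_nat modn_small// inordK. Qed.

(** Modulo z, N = z c vanishes and b is invertible with inverse u; hence z, which divides b W,
    divides W. The explicit quotient is written out. *)
Lemma bezout_factor (S : comPzRingType) (z c N W u v b t : S) :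
  z * c = N -> u * b + v * N = 1 -> b * W = z - t * N ->
  W = z * (u + c * (v * W - u * t)).
Proof.
move=> hz h1 hb; have -> : z * (u + c * (v * W - u * t)) = u * (z - t * (z * c)) + v * (z * c) * W by ring.
by rewrite hz -hb mulrA -mulrDl h1 mul1r.
Qed.

(* For primitive z0 = a + b w with u b + v N = 1, the ring morphism Z[w] -> Z/N
   sending w to r = - a u has kernel (z0). *)
Lemma eis_dvd_primitive z0 : coprimez (eis_re z0) (eis_om z0) ->
  exists r : int, forall x, eis_dvd z0 x <-> (enorm z0 %| eis_re x + r * eis_om x)%Z.
Proof.
case: z0 => a b /= cab; set N := enorm _.
have NE : N = a ^+ 2 - a * b + b ^+ 2 by [].
have [u [v huv]] : exists u v : int, u * b + v * N = 1.
  have /coprimezP[[u v] /= huv] : coprimez b N.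
    have -> : N = (b - a) * b + a ^+ 2 by rewrite NE; ring.
    by rewrite /coprimez gcdzMDl -/(coprimez _ _) coprimezXr// coprimez_sym.
  by exists u, v.
have huvb : u * b = 1 - v * N by rewrite -huv; ring.
exists (- a * u) => -[x y] /=; split.
  move=> [[p q]] /(f_equal eis_pair) [/= -> ->]; apply/dvdzP.
  exists (p * (a * v) - q * (u + v * b)).
  have -> : (p * a - q * b + - a * u * (p * b + q * a - q * b))
    = p * a * (1 - u * b) + q * (- b - u * (N - b ^+ 2) ) by rewrite NE; ring.
  have -> : - b - u * (N - b ^+ 2) = - b - u * N + (u * b) * b by ring.
  rewrite huvb; ring.
move=> /dvdzP[k hk].
have hz : Eis a b * eis_conj (Eis a b) = N%:~R.
  by rewrite eis_mul_conj eis_int eis_nat eis_normE.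
have -> : Eis x y = k%:~R * N%:~R + y%:~R * (eis_w + (a * u)%:~R).
  apply: eis_ext; rewrite !eisE/=; last by ring.
  by rewrite -hk; ring.
set W := eis_w + _.
have hbW : b%:~R * W = Eis a b - (a * v)%:~R * N%:~R.
  apply: eis_ext; rewrite !eisE/=; last by ring.
  have -> : b * (0 + a * u) - 0 * (1 + 0) = a * (u * b) by ring.
  by rewrite huvb; ring.
have h1 : u%:~R * b%:~R + v%:~R * N%:~R = 1 :> eis by rewrite -!intrM -intrD huv.
rewrite (bezout_factor hz h1 hbW).
rewrite -hz; apply: eis_dvdD.
  by apply: eis_dvdMl; apply: eis_dvdMr; exact: eis_dvd_refl.
by apply: eis_dvdMl; apply: eis_dvdMr; exact: eis_dvd_refl.
Qed.

End EisensteinArithmetic.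

(** * Residue classes, Euclidean division and primary associates *)

Section EisensteinResidues.
Set Implicit Arguments.
Unset Strict Implicit.
Local Open Scope classical_set_scope.
Implicit Types (x y z w : eis).

(** Write z = g y with y primitive of norm N. Then x lies in (z) iff g divides [eis_om x] and g N
    divides [eis_re x + r * eis_om x]; these two residues label the classes, and g * (g N) is the
    norm of z. *)
Lemma eis_residue_system z : z <> 0 -> exists (F : finType) (phi : eis -> F),
  [/\ #|F| = eis_norm z, forall x y, phi x = phi y <-> eis_dvd z (y - x) &
      forall t, exists x, phi x = t].
Proof.
move=> z0; have [g [y [g0 zE cop]]] := eis_content z0.
have y0 : y <> 0 by move=> y0; apply: z0; rewrite zE y0 mulr0.
have [r hr] := eis_dvd_primitive cop.
have N0 := eis_norm_gt0 y0; set N := eis_norm y in N0.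
have gN0 : (0 < g * N)%N by rewrite muln_gt0 g0.
have g1 : g.-1.+1 = g by rewrite prednK.
have gN1 : (g * N).-1.+1 = (g * N)%N by rewrite prednK.
exists ('I_g.-1.+1 * 'I_(g * N).-1.+1)%type.
exists (fun x => (int_mod g.-1 (eis_om x), int_mod (g * N).-1 (eis_re x + r * eis_om x))).
have key x : eis_dvd z x <-> (g %| eis_om x)%Z /\ ((g * N)%N %| eis_re x + r * eis_om x)%Z.
  have gne : g%:Z != 0 by rewrite eqz_nat -lt0n.
  split.
    move=> [w xE]; have {}xE : x = g%:R * (w * y) by rewrite xE zE; ring.
    have /hr : eis_dvd y (w * y) by exists w.
    move: (w * y) xE => t -> ; rewrite -eis_normE -/N eis_nat eis_reM eis_omM /= => h.
    have -> : g%:Z * eis_om t + 0 * eis_re t - 0 * eis_om t = eis_om t * g%:Z by ring.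
    split; first exact: dvdz_mull.
    have -> : g%:Z * eis_re t - 0 * eis_om t + r * (eis_om t * g%:Z) =
      g%:Z * (eis_re t + r * eis_om t) by ring.
    by rewrite PoszM dvdz_mul2l ?(negbTE gne).
  move=> [/dvdzP[q hq] /dvdzP[k hk]].
  have hp : eis_re x = (k * N - r * q) * g.
    by move: hk; rewrite hq PoszM => hk; rewrite -[LHS](addrK (r * (q * g))) hk; ring.
  have [w hw] : eis_dvd y (Eis (k * N - r * q) q).
    by apply/hr => /=; rewrite -eis_normE -/N subrK dvdz_mull.
  exists w; rewrite zE mulrCA -hw; apply: eis_ext; rewrite !eisE/= ?hp ?hq; ring.
split.
- by rewrite card_prod !card_ord g1 gN1 zE eis_normM eis_norm_nat -/N; ring.
- move=> x w; rewrite key eis_reD eis_omD eis_reN eis_omN.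
  have -> : eis_re w - eis_re x + r * (eis_om w - eis_om x) =
    (eis_re w + r * eis_om w) - (eis_re x + r * eis_om x) by ring.
  split; first by move=> [/int_mod_eq h1 /int_mod_eq h2]; rewrite g1 in h1; rewrite gN1 in h2.
  by move=> [h1 h2]; congr pair; apply/int_mod_eq; rewrite ?g1 ?gN1.
- move=> [i j]; exists (Eis (j%:Z - r * i%:Z) i%:Z) => /=.
  by rewrite subrK !int_mod_ord.
Qed.

Lemma ideal_norm_principal z : z <> 0 -> ideal_norm [set w * z | w in [set: eis]] = eis_norm z.
Proof.
move=> z0; have [F [phi [cF phiE phiS]]] := eis_residue_system z0.
rewrite /ideal_norm -cF.
have cosetE x : [set y | [set w * z | w in [set: eis]] (y - x)] = [set y | phi x = phi y].
  apply/seteqP; split => y /=.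
    by move=> [w _ h]; apply/phiE; exists w.
  by move=> /phiE [w h]; exists w.
pose G (t : F) := [set y | t = phi y].
have -> : [set [set y | [set w * z | w in [set: eis]] (y - x)] | x in [set: eis]] =
    [set` [fset G t | t in F]%fset].
  apply/seteqP; split => A /=.
    by move=> [x _ <-]; apply/imfsetP; exists (phi x) => //; rewrite cosetE.
  move=> /imfsetP[t _ ->]; have [x <-] := phiS t.
  by exists x => //; rewrite cosetE.
rewrite set_fsetK card_imfset/=; first by rewrite cardE.
move=> t t' h; have [x xt] := phiS t.
have : G t' x by rewrite -h.
by rewrite /G/= xt => ->.
Qed.

Lemma eis_prime_prod lam (I : finType) (P : pred I) (F : I -> eis) : eis_prime lam ->
  eis_dvd lam (\prod_(i | P i) F i) -> exists2 i, P i & eis_dvd lam (F i).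
Proof.
move=> [_ n1 pr]; rewrite -big_filter.
have : forall i, i \in [seq i <- index_enum I | P i] -> P i.
  by move=> i; rewrite mem_filter => /andP[].
elim: [seq _ <- _ | _] => [|i s IH] hs; first by rewrite big_nil.
rewrite big_cons => /pr[h|/IH]; first by exists i => //; apply: hs; rewrite inE eqxx.
by apply=> j js; apply: hs; rewrite inE js orbT.
Qed.

Lemma eis_dvd_prodB d (I : finType) (P : pred I) (F G : I -> eis) :
  (forall i, P i -> eis_dvd d (F i - G i)) ->
  eis_dvd d (\prod_(i | P i) F i - \prod_(i | P i) G i).
Proof.
move=> h; apply: (big_ind2 (fun x y => eis_dvd d (x - y))) => //.
  by rewrite subrr; exact: eis_dvd0.
by move=> *; exact: eis_dvd_mulB.
Qed.

(* Multiplication by z permutes the nonzero residue classes. *)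
Lemma eis_fermat lam z : eis_prime lam -> ~ eis_dvd lam z ->
  eis_dvd lam (z ^+ (eis_norm lam).-1 - 1).
Proof.
move=> plam nz; have [l0 l1 pr] := plam.
have [F [phi [cF phiE phiS]]] := eis_residue_system l0.
have [r rE] := choice phiS; pose t0 := phi 0.
have phi0 x : phi x = t0 <-> eis_dvd lam x.
  rewrite phiE sub0r; split; last exact: eis_dvdN.
  by move=> /eis_dvdN; rewrite opprK.
pose p t := phi (z * r t).
have pinj : injective p.
  move=> t t' /phiE; rewrite -mulrBr => /pr[//|/phiE]; by rewrite !rE.
have p0 t : (p t == t0) = (t == t0).
  apply/eqP/eqP => [/phi0 /pr[//|/phi0]|/esym]; first by rewrite rE.
  move=> tE; apply/phi0; apply: eis_dvdMl; apply/phi0; by rewrite rE.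
pose P := \prod_(t | t != t0) r t.
have nP : ~ eis_dvd lam P.
  move=> /(eis_prime_prod plam)[t /eqP tt0 /phi0]; by rewrite rE.
have : eis_dvd lam (P - z ^+ (eis_norm lam).-1 * P).
  have -> : z ^+ (eis_norm lam).-1 * P = \prod_(t | t != t0) (z * r t).
    rewrite big_split/= prodr_const -cF -(cardC1 t0); congr (_ ^+ _ * _).
  rewrite /P (reindex_inj pinj)/= (eq_bigl (fun t => t != t0)) => [|t]; last by rewrite p0.
  apply: eis_dvd_prodB => t _; apply/phiE; by rewrite rE.
have -> : P - z ^+ (eis_norm lam).-1 * P = (1 - z ^+ (eis_norm lam).-1) * P by ring.
by move=> /pr[/eis_dvd_sym|].
Qed.

Lemma int_nearest (a N : int) : 0 < N -> exists q, - N <= 2 * (a - q * N) <= N.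
Proof.
(* The integer nearest to a / N is the floor of a / N + 1 / 2. *)
move=> N0; exists ((2 * a + N) %/ (2 * N))%Z.
have N2 : 0 < 2 * N by lia.
have := divz_eq (2 * a + N) (2 * N); have := modz_ge0 (2 * a + N) (lt0r_neq0 N2).
have := ltz_pmod (2 * a + N) N2.
by move: (_ %/ _)%Z (_ %% _)%Z => q r; nia.
Qed.

(** Multiplying by the conjugate of y reduces the division to one by the integer N = N(y). Rounding
    both coordinates leaves A, B of size at most N / 2, and then A^2 - A B + B^2 <= 3 N^2 / 4. *)
Lemma eis_euclid x y : y <> 0 -> exists q, (eis_norm (x - q * y)%R < eis_norm y)%N.
Proof.
move=> y0; have N0 := eis_norm_gt0 y0; set N := eis_norm y in N0 *.
have [a ha] := @int_nearest (eis_re (x * eis_conj y)) N N0.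
have [b hb] := @int_nearest (eis_om (x * eis_conj y)) N N0.
exists (Eis a b).
have : enorm ((x - Eis a b * y) * eis_conj y) = (eis_norm (x - Eis a b * y))%:Z * N%:Z.
  by rewrite enormM -!eis_normE eis_norm_conj.
have -> : (x - Eis a b * y) * eis_conj y = x * eis_conj y - Eis a b * N%:R.
  by rewrite mulrBl -mulrA eis_mul_conj.
move: (x * eis_conj y) ha hb => t.
rewrite /enorm eis_reD eis_omD eis_reN eis_omN eis_nat eis_reM eis_omM /=.
have -> : a * N - b * 0 = a * N by ring.
have -> : a * 0 + b * N - b * 0 = b * N by ring.
move: (eis_re t - a * N) (eis_om t - b * N) => A B ha hb h.
rewrite -ltz_nat; have : 4 * (A ^+ 2 - A * B + B ^+ 2) <= 3 * N%:Z ^+ 2 by nia.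
rewrite h; move: (eis_norm _) => k; nia.
Qed.

Lemma eis_ideal_principal (I : set eis) : is_ideal I -> (exists2 x, I x & x <> 0) ->
  exists2 z, z <> 0 & I = [set w * z | w in [set: eis]].
Proof.
move=> [I0 ID IM] [x Ix x0].
pose P k := `[< exists z, [/\ I z, z <> 0 & eis_norm z = k] >].
have exP : exists k, P k by exists (eis_norm x); apply/asboolP; exists x.
case: (ex_minnP exP) => k /asboolP[z [Iz z0 zk]] kmin.
exists z => //; apply/seteqP; split => y /=; last by move=> [w _ <-]; exact: IM.
move=> Iy; have [q hq] := eis_euclid y z0.
exists q => //; apply: contrapT => ne.
have : P (eis_norm (y - q * z)).
  apply/asboolP; exists (y - q * z); split => //.
    by apply: ID => //; rewrite -mulNr; exact: IM.
  by move=> h; apply: ne; apply/esym/eqP; rewrite -subr_eq0 h.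
by move=> /kmin; rewrite leqNgt -zk hq.
Qed.

(** Since a^2 - a b + b^2 = (a + b)^2 - 3 a b, the norm is prime to 3 iff a + b is. This leaves six
    classes of (a, b) modulo 3, one for each of the six units. *)
Lemma eis_primary_associate z : ~~ (3 %| eis_norm z)%N ->
  exists2 u, eis_norm u = 1%N & eis_dvd 3 (u * z - 1).
Proof.
case: z => a b h3.
have hab : ~~ (3 %| a + b)%Z.
  apply: contra h3 => /dvdzP[k hk]; rewrite -[(_ %| _)%N]/((3 %| (eis_norm (Eis a b))%:Z)%Z).
  rewrite eis_normE /enorm/=; apply/dvdzP; exists (k * (a + b) - a * b).
  have -> : a ^+ 2 - a * b + b ^+ 2 = (a + b) * (a + b) - 3 * (a * b) by ring.
  by rewrite {1}hk; ring.
have [i [a' [hi aE]]] : exists (i : nat) (a' : int), (i < 3)%N /\ a = 3 * a' + i%:Z.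
  by exists `|(a %% 3)%Z|%N, (a %/ 3)%Z; lia.
have [j [b' [hj bE]]] : exists (i : nat) (a' : int), (i < 3)%N /\ b = 3 * a' + i%:Z.
  by exists `|(b %% 3)%Z|%N, (b %/ 3)%Z; lia.
have fin (p q : int) : eis_norm (Eis p q) = 1%N ->
    (3 %| p * a - q * b - 1)%Z -> (3 %| p * b + q * a - q * b)%Z ->
    exists2 u, eis_norm u = 1%N & eis_dvd 3 (u * Eis a b - 1).
  move=> h1 h2 h4; exists (Eis p q) => //; apply/eis_dvd_nat; split => //=.
  by rewrite oppr0 addr0.
case: i hi aE => [|[|[|//]]] _ aE; case: j hj bE => [|[|[|//]]] _ bE.
- by exfalso; lia.
- by apply: (fin (-1) (-1)) => //; lia.
- by apply: (fin 1 1) => //; lia.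
- by apply: (fin 1 0) => //; lia.
- by apply: (fin 0 (-1)) => //; lia.
- by exfalso; lia.
- by apply: (fin (-1) 0) => //; lia.
- by exfalso; lia.
- by apply: (fin 0 1) => //; lia.
Qed.

(** The six units are distinct modulo 3. With b = 3 q, the identity 4 N = (2 a - b)^2 + 3 b^2 at N =
    1 gives 27 q^2 <= 4, so b = 0. *)
Lemma eis_unit_primary u : eis_norm u = 1%N -> eis_dvd 3 (u - 1) -> u = 1.
Proof.
case: u => a b; move=> /(congr1 Posz); rewrite eis_normE => h /eis_dvd_nat[/= h1 h2].
have := enorm_mul4 (Eis a b); rewrite h /=; move: h1 h2.
rewrite subr0 => /dvdzP[p hp] /dvdzP[q hq] h4.
have sq : 0 <= (2 * a - b) ^+ 2 by exact: sqr_ge0.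
have q2 : 27 * (q * q) <= 4.
  have -> : 27 * (q * q) = 3 * b ^+ 2 by rewrite hq; ring.
  by rewrite -[X in _ <= X]/(4 * 1%N%:Z) h4 lerDr.
have q0 : q = 0 by nia.
have b0 : b = 0 by rewrite hq q0.
have p2 : p * (3 * p + 2) = 0.
  have aE : a = 3 * p + 1 by move: hp; lia.
  by move: h4; rewrite b0 aE -[4 * 1%N%:Z]/(4%:Z) => h4; nia.
have p0 : p = 0.
  by move: p2 => /eqP; rewrite mulf_eq0 => /orP[/eqP //|/eqP]; lia.
by apply: eis_ext => //=; move: hp; rewrite p0; lia.
Qed.

(** Coprimality to z is multiplicative, so a Bezout relation with n can be built one prime factor at
    a time. *)
Lemma eis_bezoutM z x y : (exists a b, a * z + b * x = 1) -> (exists a b, a * z + b * y = 1) ->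
  exists a b, a * z + b * (x * y) = 1.
Proof.
move=> [a [b h]] [a' [b' h']]; exists (a * (a' * z + b' * y) + b * x * a'), (b * b').
rewrite -[RHS]mul1r -{1}h -h'; ring.
Qed.

End EisensteinResidues.

(** * The cubic character *)

Section CubicResidue.
Set Implicit Arguments.
Unset Strict Implicit.
Local Open Scope classical_set_scope.
Implicit Types (x y z w u v lam : eis).

Lemma eis_w_sq : eis_w * eis_w = - 1 - eis_w.
Proof. by apply: eis_ext. Qed.

Lemma eis_w3 : eis_w ^+ 3 = 1.
Proof. by apply: eis_ext. Qed.

Lemma eis_cube_root u : u ^+ 3 = 1 -> [\/ u = 1, u = eis_w | u = - 1 - eis_w].
Proof.
move=> h.
have e : (u - 1) * ((u - eis_w) * (u - (- 1 - eis_w))) = 0.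
  have -> : (u - eis_w) * (u - (- 1 - eis_w)) = u * u + u - (eis_w + eis_w * eis_w) by ring.
  rewrite eis_w_sq; have -> : (u - 1) * (u * u + u - (eis_w + (- 1 - eis_w))) = u ^+ 3 - 1 by ring.
  by rewrite h subrr.
by case/eis_mul_eq0: e => [/eqP|/eis_mul_eq0[] /eqP]; rewrite subr_eq0 => /eqP ->;
  [constructor 1|constructor 2|constructor 3].
Qed.

Lemma eis_cube_root_conj u : u ^+ 3 = 1 -> eis_conj u = u -> u = 1.
Proof. by move=> /eis_cube_root [-> | -> | ->]. Qed.

Lemma eis_cube_root_sq u : u ^+ 3 = 1 -> u ^+ 2 = 1 -> u = 1.
Proof. by move=> h3 h2; rewrite -[LHS]mul1r -h2 -exprSr h3. Qed.

Lemma eis_prime_norm lam : eis_prime lam -> (1 < eis_norm lam)%N.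
Proof.
move=> [l0 l1 _]; have := eis_norm_gt0 l0.
rewrite leq_eqVlt => /orP[/eqP h|//]; exfalso; apply: l1.
by exists (eis_conj lam); rewrite mulrC eis_norm_unit.
Qed.

Lemma eis_prime_exp lam x k : eis_prime lam -> eis_dvd lam (x ^+ k) -> eis_dvd lam x.
Proof.
move=> [_ l1 pr]; elim: k => [|k IH]; first by rewrite expr0.
by rewrite exprS => /pr[|/IH].
Qed.

Lemma eis_prime_conj lam : eis_prime lam -> eis_prime (eis_conj lam).
Proof.
move=> [l0 l1 pr]; split.
- by move=> h; apply: l0; rewrite -[lam]eis_conjK h; apply: eis_ext.
- move=> /eis_dvd_conj; rewrite eis_conjK (_ : eis_conj 1 = 1)//.
- move=> x y /eis_dvd_conj; rewrite eis_conjK eis_conjM.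
  by move=> /pr[/eis_dvd_conj|/eis_dvd_conj]; rewrite !eis_conjK; [left|right].
Qed.

Lemma eis_prime_dvd lam mu : eis_prime lam -> eis_prime mu -> eis_dvd lam mu -> eis_dvd mu lam.
Proof.
move=> [l0 l1 _] [m0 m1 pr] [w hw].
have /pr[[t ht]|//] : eis_dvd mu (w * lam) by rewrite -hw; exact: eis_dvd_refl.
exfalso; apply: l1; exists t; apply: (eis_mulI m0).
by rewrite mulr1 {1}hw ht; ring.
Qed.

(** Modulo 3 the norm of a + b w is the square of a + b, hence 1 if it is not 0. This makes the
    exponent in [cubic_residue] an exact third of N - 1. *)
Lemma eis_norm_mod3 z : ~~ (3 %| eis_norm z)%N -> (eis_norm z).-1 = ((eis_norm z).-1 %/ 3 * 3)%N.
Proof.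
move=> h; suff : (eis_norm z %% 3 = 1)%N by lia.
have : (eis_norm z)%:Z = (eis_re z + eis_om z) ^+ 2 - 3 * (eis_re z * eis_om z).
  by rewrite eis_normE /enorm; ring.
move: (eis_re z + eis_om z) (eis_re z * eis_om z) h => s p h.
have [i [q [hi ->]]] : exists (i : nat) (q : int), (i < 3)%N /\ s = 3 * q + i%:Z.
  by exists `|(s %% 3)%Z|%N, (s %/ 3)%Z; lia.
have -> : (3 * q + i%:Z) ^+ 2 - 3 * p = 3 * (3 * q ^+ 2 + 2 * q * i%:Z - p) + (i ^ 2)%N%:Z.
  by rewrite -[(i ^ 2)%N]/(i * i)%N PoszM; ring.
move: (_ - p) => t; case: i hi => [|[|[|//]]] _; move: (eis_norm z) h => N; lia.
Qed.

(** The primes not above 3. Modulo a prime above 3 the three cube roots of unity coincide, so they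
    cannot be told apart by congruence. *)
Definition cubic_prime lam : Prop := eis_prime lam /\ ~~ (3 %| eis_norm lam)%N.

(** Two distinct cube roots of unity differ by an element of norm 3, so [eis_norm lam] would be
    3. *)
Lemma cube_root_congr lam u v : cubic_prime lam -> u ^+ 3 = 1 -> v ^+ 3 = 1 ->
  eis_dvd lam (u - v) -> u = v.
Proof.
move=> [pl h3] hu hv /eis_dvd_norm hd; apply/eqP/negPn/negP => /eqP uv.
have e : eis_norm (u - v) = 3%N.
  by case/eis_cube_root: hu uv => ->; case/eis_cube_root: hv => ->.
move: hd; rewrite e => hd; have hle := @dvdn_leq _ 3 isT hd.
have := eis_prime_norm pl; move: h3 hle hd; move: (eis_norm lam) => [|[|[|[|//]]]]//.
Qed.

Lemma cubic_residue_dvd z lam : eis_dvd lam z -> cubic_residue z lam = 0.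
Proof. by move=> h; rewrite /cubic_residue asboolT. Qed.

(** With y = z^((N - 1) / 3), Fermat gives lam | y^3 - 1 = (y - 1)(y - w)(y - w^2), and the prime
    lam divides one of the factors. *)
Lemma cubic_residueP z lam : cubic_prime lam -> ~ eis_dvd lam z ->
  cubic_residue z lam ^+ 3 = 1 /\
  eis_dvd lam (z ^+ ((eis_norm lam).-1 %/ 3) - cubic_residue z lam).
Proof.
move=> [pl h3] nz; rewrite /cubic_residue asboolF//.
set P := [set u | _].
suff [u hu] : exists u, P u by have := @xgetI _ 0 P u hu.
have := eis_fermat pl nz; rewrite (eis_norm_mod3 h3) exprM.
set y := z ^+ _ => h; have [_ _ pr] := pl.
have {h} : eis_dvd lam ((y - 1) * ((y - eis_w) * (y - (- 1 - eis_w)))).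
  have -> : (y - eis_w) * (y - (- 1 - eis_w)) = y * y + y - (eis_w + eis_w * eis_w) by ring.
  rewrite eis_w_sq; suff -> : (y - 1) * (y * y + y - (eis_w + (- 1 - eis_w))) = y ^+ 3 - 1 by [].
  by ring.
move=> /pr[h|/pr[]h]; [exists 1|exists eis_w|exists (- 1 - eis_w)]; split => //=.
Qed.

Lemma cubic_residue_eq z lam u : cubic_prime lam -> ~ eis_dvd lam z -> u ^+ 3 = 1 ->
  eis_dvd lam (z ^+ ((eis_norm lam).-1 %/ 3) - u) -> cubic_residue z lam = u.
Proof.
move=> cl nz hu hd; have [h3 hd'] := cubic_residueP cl nz.
apply: (cube_root_congr cl h3 hu).
move: (z ^+ _) hd hd' => y hd hd'.
have -> : cubic_residue z lam - u = (y - u) - (y - cubic_residue z lam) by ring.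
exact: eis_dvdB.
Qed.

Lemma cubic_residueM x y lam : cubic_prime lam ->
  cubic_residue (x * y) lam = cubic_residue x lam * cubic_residue y lam.
Proof.
move=> cl; have [[_ _ pr] _] := cl.
case: (pselect (eis_dvd lam x)) => [hx|hx].
  by rewrite !(cubic_residue_dvd hx) mul0r cubic_residue_dvd//; exact: eis_dvdMr.
case: (pselect (eis_dvd lam y)) => [hy|hy].
  by rewrite !(cubic_residue_dvd hy) mulr0 cubic_residue_dvd//; exact: eis_dvdMl.
have [hx3 hxd] := cubic_residueP cl hx; have [hy3 hyd] := cubic_residueP cl hy.
apply: cubic_residue_eq => //; first by move=> /pr[].
  by rewrite exprMn hx3 hy3 mulr1.
by rewrite exprMn; exact: eis_dvd_mulB.
Qed.

Lemma cubic_residue_conj z lam : cubic_prime lam ->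
  cubic_residue (eis_conj z) (eis_conj lam) = eis_conj (cubic_residue z lam).
Proof.
move=> cl; have [pl h3] := cl.
have cl' : cubic_prime (eis_conj lam).
  by split; [exact: eis_prime_conj|rewrite eis_norm_conj].
case: (pselect (eis_dvd lam z)) => [hz|hz].
  by rewrite (cubic_residue_dvd hz) (cubic_residue_dvd (eis_dvd_conj hz)).
have [hx3 hxd] := cubic_residueP cl hz.
apply: cubic_residue_eq => //.
- by move=> /eis_dvd_conj; rewrite !eis_conjK.
- by rewrite -eis_conjX hx3.
- by rewrite eis_norm_conj -eis_conjX -eis_conjN -eis_conjD; exact: eis_dvd_conj.
Qed.

Lemma cubic_residue_associate z lam mu : eis_dvd lam mu -> eis_dvd mu lam ->
  cubic_residue z lam = cubic_residue z mu.
Proof.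
move=> h1 h2; have dE x : eis_dvd lam x = eis_dvd mu x.
  by apply/propext; split; exact: eis_dvd_trans.
have nE : eis_norm lam = eis_norm mu.
  by apply/eqP; rewrite eqn_dvd !eis_dvd_norm.
rewrite /cubic_residue dE nE; case: ifP => // _.
by congr xget; apply/seteqP; split => u /=; rewrite dE.
Qed.

(** Uniqueness of the exponent of p, needed to see that conjugate prime factors of n occur with
    equal exponents. *)
Lemma eis_val_unique p x y a b : eis_prime p -> ~ eis_dvd p x -> ~ eis_dvd p y ->
  p ^+ a * x = p ^+ b * y -> a = b.
Proof.
move=> pp.
have hlt a' b' x' y' : ~ eis_dvd p x' -> (a' < b')%N -> p ^+ a' * x' = p ^+ b' * y' -> False.
  move=> nx ab h; apply: nx.
  have pa : p ^+ a' <> 0.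
    by move=> h0; have [p0 _ _] := pp; apply: p0; have := eis_normX p a';
      rewrite h0 eis_norm0 => /esym/eqP; rewrite expn_eq0 => /andP[/eqP N0 _];
      apply: enorm_eq0; rewrite -eis_normE N0.
  exists (p ^+ (b' - a').-1 * y'); apply: (eis_mulI pa).
  have -> : p ^+ a' * (p ^+ (b' - a').-1 * y' * p) = p ^+ a' * (p ^+ (b' - a').-1 * p) * y' by ring.
  by rewrite h -exprSr -exprD; congr (_ ^+ _ * _); lia.
move=> nx ny h; case: (ltngtP a b) => // ab; exfalso.
  exact: hlt nx ab h.
exact: hlt ny ab (esym h).
Qed.

End CubicResidue.

(** * The character [chi] attached to a factorization of n *)

Section CubicCharacter.
Set Implicit Arguments.
Unset Strict Implicit.
Implicit Types (x y z : eis).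

Variables (n m : nat) (lam : 'I_m -> eis) (c : 'I_m -> nat).
Hypothesis n_coprime3 : coprime n 3.
Hypothesis n_fact : eis_prime_factorization n lam c.

Lemma lam_prime i : eis_prime (lam i).
Proof. by have [h _ _ _] := n_fact. Qed.

Lemma lam_dvd_n i : eis_dvd (lam i) n%:R.
Proof.
have [_ _ c0 ->] := n_fact; rewrite (bigD1 i)//=; apply: eis_dvdMr.
by rewrite -(prednK (c0 i)) exprS; apply: eis_dvdMr; exact: eis_dvd_refl.
Qed.

(** The norm of a factor of n divides n^2, which is prime to 3. *)
Lemma lam_cubic i : cubic_prime (lam i).
Proof.
split; first exact: lam_prime.
have := eis_dvd_norm (lam_dvd_n i); rewrite eis_norm_nat => hd.
apply/negP => h3; have := dvdn_trans h3 hd; rewrite Euclid_dvdX// andbT => h.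
by move: n_coprime3; rewrite coprime_sym prime_coprime// h.
Qed.

Lemma chiM x y : chi lam c (x * y) = chi lam c x * chi lam c y.
Proof.
rewrite /chi -big_split/=; apply: eq_bigr => i _.
by rewrite cubic_residueM ?exprMn//; exact: lam_cubic.
Qed.

Lemma chi_dvd_eq0 z i : eis_dvd (lam i) z -> chi lam c z = 0.
Proof.
have [_ _ c0 _] := n_fact => h.
by rewrite /chi (bigD1 i)//= cubic_residue_dvd// expr0n gtn_eqF// mul0r.
Qed.

Lemma chi_cube z : (forall i, ~ eis_dvd (lam i) z) -> chi lam c z ^+ 3 = 1.
Proof.
move=> h; rewrite /chi -prodrXl big1// => i _.
by rewrite exprAC; have [-> _] := cubic_residueP (lam_cubic i) (h i); rewrite expr1n.
Qed.

Lemma chi_neq0 z : chi lam c z <> 0 <-> forall i, ~ eis_dvd (lam i) z.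
Proof.
split=> [h i /chi_dvd_eq0 //|/chi_cube h3 h].
by move: h3; rewrite h expr0n/= => /eqP; rewrite eq_sym oner_eq0.
Qed.

Lemma chi_cube_neq0 z : chi lam c z <> 0 -> chi lam c z ^+ 3 = 1.
Proof. by move=> /chi_neq0; exact: chi_cube. Qed.

Lemma chi_unit u : eis_norm u = 1%N -> chi lam c u <> 0.
Proof.
move=> hu; apply/chi_neq0 => i hd; have [_ l1 _] := lam_prime i; apply: l1.
by rewrite -(eis_norm_unit hu); exact: eis_dvdMr.
Qed.

(** chi(-1) is a cube root and also a square root of 1. *)
Lemma chiN1 : chi lam c (- 1) = 1.
Proof.
have h : chi lam c (-1) ^+ 3 = 1 by apply: chi_cube_neq0; exact: chi_unit.
have h1 : chi lam c 1 = 1.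
  by apply: (@eis_mulI (chi lam c 1)); [exact: chi_unit|rewrite -chiM !mulr1].
by apply: eis_cube_root_sq => //; rewrite expr2 -chiM mulrNN mulr1.
Qed.

Lemma chi_coprime z : (forall i, ~ eis_dvd (lam i) z) -> exists a b, a * z + b * n%:R = 1.
Proof.
move=> h; have [_ _ _ ->] := n_fact.
have base : exists a b, a * z + b * 1 = 1 by exists 0, 1; rewrite mul0r add0r mulr1.
apply: (big_ind (fun x => exists a b, a * z + b * x = 1)) => //.
  by move=> x y; exact: eis_bezoutM.
move=> i _; elim: (c i) => // k IH; rewrite exprS; apply: eis_bezoutM => //.
have [w hw] := eis_fermat (lam_prime i) (h i).
have N1 := eis_prime_norm (lam_prime i).
(* By Fermat z^(N - 2) inverts z modulo lam_i. *)
exists (z ^+ (eis_norm (lam i)).-2), (- w).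
rewrite mulNr -hw -exprSr prednK; last by case: (eis_norm (lam i)) N1 => [|[|j]].
by ring.
Qed.

(** Conjugation fixes n, so it sends each lam_i to an associate of some lam_(s i) with the same
    exponent, and s is a permutation; reindexing the product along s gives the claim. *)
Lemma chi_conj z : chi lam c (eis_conj z) = eis_conj (chi lam c z).
Proof.
have [pl ndvd c0 nE] := n_fact.
(* The cofactor of the full power of lam_i in n, prime to lam_i. *)
pose M i := \prod_(j | j != i) lam j ^+ c j.
have nM i : n%:R = lam i ^+ c i * M i by rewrite nE (bigD1 i).
have lM i : ~ eis_dvd (lam i) (M i).
  move=> /(eis_prime_prod (pl i))[j ji /(eis_prime_exp (pl i))].
  by apply: ndvd; rewrite eq_sym.
have /choice[s hs] : forall i, exists j, eis_dvd (eis_conj (lam i)) (lam j).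
  move=> i; have := eis_dvd_conj (lam_dvd_n i); rewrite eis_conj_nat nE.
  move=> /(eis_prime_prod (eis_prime_conj (pl i)))[j _] /(eis_prime_exp (eis_prime_conj (pl i))).
  by exists j.
have hs' i : eis_dvd (lam (s i)) (eis_conj (lam i)).
  by apply: eis_prime_dvd => //; exact: eis_prime_conj.
have sinj : injective s.
  move=> i i' e; apply/eqP/negPn/negP => /ndvd; apply.
  have := eis_dvd_trans (hs i); rewrite e => /(_ _ (hs' i'))/eis_dvd_conj.
  by rewrite !eis_conjK.
(* The exponent of lam_(s i) in n is computed twice: directly, and from n = conj n, where
   conj(lam_i) = v lam_(s i) with v a unit. *)
have sc i : c (s i) = c i.
  have [v hv] := hs' i; have [w hw] := hs i.
  have vw : v * w = 1.
    have l0 : eis_conj (lam i) <> 0 by have [] := eis_prime_conj (pl i).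
    by apply: (eis_mulI l0); rewrite mulr1 {2}hv hw; ring.
  have nv : ~ eis_dvd (lam (s i)) v.
    by move=> h; have [_ l1 _] := pl (s i); apply: l1; rewrite -vw; exact: eis_dvdMr.
  apply: (@eis_val_unique (lam (s i)) (M (s i)) (v ^+ c i * eis_conj (M i))) => //.
    have [_ _ pr] := pl (s i); move=> /pr[/(eis_prime_exp (pl (s i)))//|h].
    apply: (lM i); have := eis_dvd_conj (eis_dvd_trans (hs i) h).
    by rewrite !eis_conjK.
  rewrite -nM -(eis_conj_nat n) (nM i) eis_conjM eis_conjX hv exprMn; ring.
rewrite /chi eis_conj_prod (reindex_inj sinj)/=; apply: eq_bigr => i _.
rewrite sc eis_conjX -(cubic_residue_conj z (lam_cubic i)); congr (_ ^+ _).
by apply: cubic_residue_associate.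
Qed.

(** By [chi_conj] the value is a cube root of unity fixed by conjugation, and 1 is the only one. *)
Lemma chi_nat (k : nat) : coprime k n -> chi lam c k%:R = 1.
Proof.
move=> ckn; apply: eis_cube_root_conj; last by rewrite -chi_conj eis_conj_nat.
apply: chi_cube => i hk; have [_ l1 _] := lam_prime i; apply: l1.
have [u [v huv]] : exists u v : int, u * k%:Z + v * n%:Z = 1.
  have /coprimezP[[u v] /= h] : coprimez k n by rewrite /coprimez /gcdz/=; apply/eqP; congr Posz; exact/eqP.
  by exists u, v.
have -> : 1 = u%:~R * k%:R + v%:~R * n%:R :> eis.
  by rewrite -[k%:R]/((k%:Z)%:~R) -[n%:R]/((n%:Z)%:~R) -!intrM -intrD huv.
by apply: eis_dvdD; apply: eis_dvdMl => //; exact: lam_dvd_n.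
Qed.

(** With k_i = (N(lam_i) - 1) / 3, the symbol of w at lam_i equals w^(k_i), so chi(w) = w^S for S
    the sum of the k_i c_i. Taking norms, n^2 is the product of the (1 + 3 k_i)^(c_i), which is 1 +
    3 S modulo 9. Thus chi(w) = 1 forces n^2 = 1 modulo 9, that is n = 1 or 8. *)
Lemma chi_w_neq1 : (n %% 9 != 1)%N -> (n %% 9 != 8)%N -> chi lam c eis_w <> 1.
Proof.
move=> n1 n8 h.
pose k i := ((eis_norm (lam i)).-1 %/ 3)%N.
have kE i : eis_norm (lam i) = (3 * k i + 1)%N.
  have [pl h3] := lam_cubic i; have := eis_norm_mod3 h3; have := eis_prime_norm pl.
  by rewrite -/(k i); lia.
have crw i : cubic_residue eis_w (lam i) = eis_w ^+ k i.
  apply: cubic_residue_eq; first exact: lam_cubic.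
  - by have := chi_unit (erefl : eis_norm eis_w = 1%N) => /chi_neq0.
  - by rewrite exprAC eis_w3 expr1n.
  - by rewrite subrr; exact: eis_dvd0.
pose S := (\sum_i k i * c i)%N.
have : eis_w ^+ S = 1.
  rewrite -h /chi -prodrXr; apply: eq_bigr => i _; by rewrite crw exprM.
rewrite {1}(divn_eq S 3) exprD mulnC exprM eis_w3 expr1n mul1r => hS.
have S0 : (S %% 3 = 0)%N by have := ltn_pmod S (isT : 0 < 3)%N; case: (S %% 3)%N hS => [|[|[|//]]].
have : (n ^ 2 = 1 + 3 * S %[mod 9])%N.
  have [_ _ _ nE] := n_fact.
  rewrite -eis_norm_nat nE eis_norm_prod /S.
  (* To first order, products of the numbers 1 + 3 x become sums of the x: the term 9 x' y' vanishes
     modulo 9. *)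
  have step (x y x' y' : nat) : (x = 1 + 3 * x' %[mod 9] -> y = 1 + 3 * y' %[mod 9] ->
      x * y = 1 + 3 * (x' + y') %[mod 9])%N.
    move=> hx hy; rewrite -modnMm hx hy modnMm.
    have -> : ((1 + 3 * x') * (1 + 3 * y') = (x' * y') * 9 + (1 + 3 * (x' + y')))%N by ring.
    by rewrite modnMDl.
  apply: (big_ind2 (fun x y : nat => x = 1 + 3 * y %[mod 9])%N) => //.
    by move=> x x' y y'; exact: step.
  move=> i _; rewrite eis_normX kE; elim: (c i) => [|j IH]; first by rewrite muln0.
  by rewrite expnS mulnS; apply: step => //; rewrite addnC.
have -> : (1 + 3 * S = (S %/ 3) * 9 + 1)%N by move: S0; lia.
rewrite modnMDl -modnXm.
move: n1 n8 (ltn_pmod n (isT : 0 < 9)%N).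
by move: (n %% 9)%N => [|[|[|[|[|[|[|[|[|?]]]]]]]]].
Qed.

End CubicCharacter.

(** * Complex powers and the embedding of the Eisenstein integers *)

Section ComplexPowers.
Set Implicit Arguments.
Unset Strict Implicit.
Variable R : realType.
Implicit Types (s z : R[i]) (x y : R).

Lemma expCD (a b : R[i]) : expC (a + b) = expC a * expC b.
Proof.
case: a b => [a1 a2] [b1 b2]; rewrite /expC /= expRD cosD sinD.
by apply/eqP; rewrite eq_complex /=; apply/andP; split; apply/eqP; ring.
Qed.

Lemma expC0 : expC (0 : R[i]) = 1.
Proof.
rewrite /expC /= expR0 cos0 sin0; apply/eqP; rewrite eq_complex /=.
by rewrite !mulr0 !mul0r subr0 mulr1 addr0 !eqxx.
Qed.

Lemma expC_norm (a : R[i]) : `|expC a| = (expR (complex.Re a))%:C.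
Proof.
rewrite /expC normrM !normc_def/= cos2Dsin2 sqrtr1 expr0n/= addr0 sqrtr_sqr mulr1.
by rewrite ger0_norm// expR_ge0.
Qed.

Lemma cpowM x y s : 0 < x -> 0 < y -> cpow (x * y) s = cpow x s * cpow y s.
Proof. by move=> x0 y0; rewrite /cpow lnM// rmorphD/= mulrDr expCD. Qed.

Lemma cpow1 s : cpow 1 s = 1.
Proof. by rewrite /cpow ln1 mulr0 expC0. Qed.

Lemma cpow_neq0 x s : cpow x s != 0.
Proof.
rewrite -normr_eq0 /cpow expC_norm; apply/eqP => /(congr1 (@complex.Re R))/=/eqP.
by rewrite gt_eqF// expR_gt0.
Qed.

Lemma cpowN x s : cpow x (- s) = (cpow x s)^-1.
Proof.
apply: (mulfI (cpow_neq0 x s)); rewrite mulfV ?cpow_neq0//.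
by rewrite /cpow -expCD -mulrDl subrr mul0r expC0.
Qed.

Lemma cpow_div x y s : 0 < x -> 0 < y -> cpow (x / y) s = cpow x s * cpow y (- s).
Proof.
move=> x0 y0; have := @cpowM (x / y) y s (divr_gt0 x0 y0) y0.
rewrite divfK ?gt_eqF// => ->; rewrite cpowN mulfK//; exact: cpow_neq0.
Qed.

Lemma cpow_sqr x s : 0 < x -> cpow (x ^+ 2) (- s) = cpow x (- (2 * s)).
Proof.
by move=> x0; rewrite /cpow lnXn// mulr2n rmorphD/=; congr expC; ring.
Qed.

Lemma cpow_norm x s : 0 < x -> `|cpow x s| = (x `^ complex.Re s)%:C.
Proof.
move=> x0; rewrite /cpow expC_norm /powR gt_eqF//; congr (expR _)%:C.
by case: s => a b /=; rewrite mulr0 subr0.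
Qed.

(** For t = 2 pi / 3 one has 2 t = 2 pi - t, so duplication gives 2 cos(t)^2 - 1 = cos t. The root
    cos t = 1 is excluded by sin t > 0. *)
Lemma omegaE : omega R = (- (2^-1)) +i* (Num.sqrt 3 / 2).
Proof.
rewrite /omega /expC /= expR0.
set t : R := 2 * pi / 3.
have [t2 tpi] : t *+ 2 = pi *+ 2 - t /\ 0 < t < pi.
  rewrite /t; have := pi_gt0 R; move: (pi : R) => p p0.
  by split; [rewrite !mulr2n; field|lra].
have st : 0 < sin t by exact: sin_gt0_pi.
have ct : cos t ^+ 2 *+ 2 - 1 = cos t.
  by rewrite -cos_mulr2n t2 cosD cosN sinN cos2pi sin2pi mul1r mul0r subr0.
have sc := cos2Dsin2 t.
have c1 : cos t = - (2^-1).
  have /eqP : (cos t - 1) * (2 * cos t + 1) = 0 by move: ct; rewrite mulr2n => ct; nra.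
  rewrite mulf_eq0 => /orP[/eqP c1|/eqP c1]; last by lra.
  have c11 : cos t = 1 by lra.
  by exfalso; move: sc; rewrite c11; nra.
have s1 : sin t = Num.sqrt 3 / 2.
  have h : (sin t * 2) ^+ 2 = 3 by move: sc; rewrite c1; nra.
  by rewrite -h sqrtr_sqr ger0_norm ?mulfK//; lra.
by apply/eqP; rewrite eq_complex /= c1 s1; apply/andP; split; apply/eqP; ring.
Qed.

Lemma omega_sqr : omega R * omega R = - 1 - omega R.
Proof.
rewrite omegaE; apply/eqP; rewrite eq_complex /=.
have h3 : Num.sqrt (3 : R) ^+ 2 = 3 by rewrite sqr_sqrtr.
by apply/andP; split; apply/eqP; [nra|lra].
Qed.

Lemma omega_conj : (omega R)^* = - 1 - omega R.
Proof.
by rewrite omegaE; apply/eqP; rewrite eq_complex /=; apply/andP; split; apply/eqP; lra.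
Qed.

Lemma eisCM (x y : eis) : eisC R (x * y) = eisC R x * eisC R y.
Proof.
rewrite /eisC eis_reM eis_omM !rmorphB/= rmorphD/= !rmorphM/=.
move: (eis_re x)%:~R (eis_om x)%:~R (eis_re y)%:~R (eis_om y)%:~R => a b a' b'.
have -> : (a + b * omega R) * (a' + b' * omega R) =
  a * a' + (a * b' + b * a') * omega R + b * b' * (omega R * omega R) by ring.
rewrite omega_sqr; ring.
Qed.

Lemma eisC1 : eisC R 1 = 1.
Proof. by rewrite /eisC /= mul0r addr0. Qed.

Lemma eisC0 : eisC R 0 = 0.
Proof. by rewrite /eisC /= mul0r addr0. Qed.

Lemma eisCX (x : eis) k : eisC R (x ^+ k) = eisC R x ^+ k.
Proof. by elim: k => [|k IH]; [exact: eisC1|rewrite !exprS eisCM IH]. Qed.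

Lemma eisC_conj (x : eis) : eisC R (eis_conj x) = (eisC R x)^*.
Proof.
rewrite /eisC (rmorphD (@conjc R)) (rmorphM (@conjc R)) !(rmorph_int (@conjc R)).
rewrite [X in _ = _ + _ * X](_ : _ = - 1 - omega R); last exact: omega_conj.
rewrite -[eis_re (eis_conj x)]/(eis_re x - eis_om x) -[eis_om (eis_conj x)]/(- eis_om x).
by rewrite intrB mulrNz; ring.
Qed.

Lemma eisC_w : eisC R eis_w = omega R.
Proof. by rewrite /eisC /= add0r mul1r. Qed.

Lemma eisC_sqnorm (x : eis) : `|eisC R x| ^+ 2 = (eis_norm x)%:R.
Proof.
rewrite sqr_normc -eisC_conj -eisCM eis_mul_conj eis_nat /eisC/= mul0r addr0.
by rewrite -pmulrn.
Qed.

End ComplexPowers.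

(** * Absolute convergence *)

Section Convergence.
Set Implicit Arguments.
Unset Strict Implicit.
Local Open Scope classical_set_scope.
Variable R : realType.
Implicit Types (s t : R[i]).

Lemma abs_bounded_complex (T : choiceType) (D : set T) (f : T -> R) (g : T -> R[i]) :
  (forall x, D x -> `|g x| <= (f x)%:C) -> abs_bounded D f -> abs_bounded D g.
Proof.
move=> fg [M hM]; exists M%:C => A hA.
apply: le_trans (_ : (\sum_(x <- A) `|f x|)%:C <= _); last by rewrite lecR; exact: hM.
rewrite rmorph_sum/= big_seq [leRHS]big_seq; apply: ler_sum => x xA.
by apply: le_trans (fg _ (hA _ xA)) _; rewrite lecR ler_norm.
Qed.

(** The maximum gives the index 0 weight 1, because a coordinate of a nonzero Eisenstein integer may
    vanish. *)
Definition nat_weight (sg : R) (k : nat) : R := (maxn 1 k)%:R `^ (- sg).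

Lemma nat_weight_ge0 sg k : 0 <= nat_weight sg k.
Proof. exact: powR_ge0. Qed.

Lemma ler_powRN (sg x y : R) : 0 <= sg -> 0 < x -> x <= y -> y `^ (- sg) <= x `^ (- sg).
Proof.
move=> sg0 x0 xy; have y0 := lt_le_trans x0 xy.
rewrite !powRN lef_pV2 ?posrE ?powR_gt0//.
by apply: ge0_ler_powR => //; rewrite nnegrE ltW.
Qed.

Lemma powR_lt1 (sg x : R) : 0 < sg -> 1 < x -> x `^ (- sg) < 1.
Proof.
move=> sg0 x1; have x0 : 0 < x by apply: lt_trans x1.
rewrite /powR gt_eqF// -[ltRHS]expR0 ltr_expR mulNr oppr_lt0 mulr_gt0// ln_gt0//.
Qed.

(* The dyadic estimate S(2K) <= 2 + q S(K) with q = 2^(1 - sg) < 1 bounds S. *)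
Lemma nat_weight_bounded sg : 1 < sg -> abs_bounded [set: nat] (nat_weight sg).
Proof.
move=> sg1; have sg0 : 0 <= sg by lra.
pose w := nat_weight sg; pose S K := \sum_(0 <= k < K) w k.
pose q : R := 2 `^ (1 - sg).
have q0 : 0 <= q by exact: powR_ge0.
have q1 : q < 1.
  rewrite /q (_ : 1 - sg = - (sg - 1)); last by ring.
  by apply: powR_lt1; lra.
have hw0 k : 0 <= w k by exact: nat_weight_ge0.
have w2 k : (0 < k)%N -> w k.*2 + w k.*2.+1 <= q * w k.
  move=> k0; have h1 : w k.*2.+1 <= w k.*2.
    by apply: ler_powRN => //; rewrite ?ltr0n ?ler_nat; lia.
  have h2 : w k.*2 = 2 `^ (- sg) * w k.
    rewrite /w /nat_weight (_ : maxn 1 k.*2 = 2 * maxn 1 k)%N; last by lia.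
    by rewrite natrM powRM// ler0n.
  have h3 : q = 2 * 2 `^ (- sg).
    by rewrite /q powRD ?pnatr_eq0 ?implybT// powRr1.
  rewrite (le_trans (lerD (lexx _) h1))// h2 h3 le_eqVlt; apply/orP; left; apply/eqP; ring.
have S2 K : S K.*2 <= 2 + q * S K.
  elim: K => [|K IH]; first by rewrite /S !big_geq// mulr0 addr0.
  rewrite doubleS /S !big_nat_recr//= -!/(S _) -addrA.
  (* The indices 0 and 1, each of weight 1, account for the constant 2. *)
  case: (posnP K) => [->|K0].
    have [-> ->] : w 0.*2 = 1 /\ w 0.*2.+1 = 1 by rewrite /w /nat_weight /= !powR1.
    rewrite /S !big_geq//= !add0r.
    by rewrite mulr1; move: q0; lra.
  by rewrite mulrDr [leRHS]addrA; apply: lerD => //; exact: w2.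
have SK K : S K <= 2 / (1 - q).
  have h : S K <= S K.*2.
    rewrite /S [leRHS](@big_cat_nat _ _ _ K)//=; last by rewrite -addnn leq_addr.
    by rewrite lerDl; apply: sumr_ge0.
  rewrite ler_pdivlMr ?subr_gt0//; have := le_trans h (S2 K); move: (S K) => x; lra.
exists (2 / (1 - q)) => A _.
rewrite (eq_bigr w) => [|k _]; last by rewrite ger0_norm.
apply: le_trans (SK (\max_(k <- A) k).+1).
rewrite /S -(big_fset_of_seq w (iota_uniq 0 (\max_(k <- A) k).+1)).
apply: ler_sum_fsubset => //; apply/fsubsetP => k kA.
rewrite mem_fset_of_seq mem_iota/= add0n ltnS; exact: leq_bigmax_seq.
Qed.

Lemma int_weight_bounded sg : 1 < sg -> abs_bounded [set: int] (fun a => nat_weight sg `|a|%N).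
Proof.
move=> /nat_weight_bounded h.
apply: (@abs_bounded_subset _ _ _ ([set a : int | 0 <= a] `|` [set a : int | a < 0])).
  by move=> a _ /=; case: (leP 0 a) => ?; [left|right].
apply: abs_boundedU; apply: (abs_bounded_surj (g := absz)) h => //= a b; lia.
Qed.

(** From (|a| - |b|)^2 >= 0 the norm is at least |a| |b|. The family N(z)^(-s) is then majorized by
    a product of weights of the two coordinates, and the one-dimensional bound suffices. *)
Lemma eis_norm_ge (z : eis) : z <> 0 ->
  (maxn 1 `|eis_re z| * maxn 1 `|eis_om z| <= eis_norm z)%N.
Proof.
move=> z0; have N0 := eis_norm_gt0 z0.
have : (eis_norm z)%:Z = eis_re z ^+ 2 - eis_re z * eis_om z + eis_om z ^+ 2 by exact: eis_normE.
move: (eis_re z) (eis_om z) (eis_norm z) N0 => a b N N0 NE.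
have hab : a * b <= `|a|%N%:Z * `|b|%N%:Z.
  by rewrite -PoszM -abszM; lia.
have ha : a ^+ 2 = `|a|%N%:Z * `|a|%N%:Z by rewrite -PoszM -abszM; nia.
have hb : b ^+ 2 = `|b|%N%:Z * `|b|%N%:Z by rewrite -PoszM -abszM; nia.
have : `|a|%N%:Z * `|a|%N%:Z - `|a|%N%:Z * `|b|%N%:Z + `|b|%N%:Z * `|b|%N%:Z <= N%:Z.
  by rewrite NE ha hb; lia.
move: `|a|%N `|b|%N => A B h.
have hs : A%:Z * B%:Z <= N%:Z.
  have : 0 <= (A%:Z - B%:Z) ^+ 2 by exact: sqr_ge0.
  have -> : (A%:Z - B%:Z) ^+ 2 = A%:Z * A%:Z - 2 * (A%:Z * B%:Z) + B%:Z * B%:Z by ring.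
  by lia.
rewrite -lez_nat PoszM; case: (posnP A) h hs => [->|A0] h hs.
  case: (posnP B) h => [->|B0] h; first by rewrite /= mulr1; lia.
  by rewrite (maxn_idPr B0) (maxn_idPl (leq0n 1)) mul1r; nia.
case: (posnP B) h hs => [->|B0] h hs; last by rewrite (maxn_idPr B0) (maxn_idPr A0).
by rewrite (maxn_idPr A0) (maxn_idPl (leq0n 1)) mulr1; nia.
Qed.

Lemma eis_norm_bounded s : 1 < complex.Re s ->
  abs_bounded [set z : eis | z <> 0] (fun z => cpow (eis_norm z)%:R (- s)).
Proof.
move=> s1; set sg := complex.Re s in s1.
have h := int_weight_bounded s1.
apply: (@abs_bounded_complex _ _ (fun z => nat_weight sg `|eis_re z|%N * nat_weight sg `|eis_om z|%N)).
  move=> z z0; have N0 := eis_norm_gt0 z0.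
  rewrite cpow_norm ?ltr0n// lecR /nat_weight -powRM ?ler0n// -natrM.
  rewrite (_ : complex.Re (- s) = - sg); last by rewrite /sg; case: (s).
  apply: ler_powRN; rewrite ?ltr0n ?ler_nat ?eis_norm_ge//; first by lra.
  by rewrite muln_gt0; lia.
apply: (abs_bounded_surj (g := eis_pair)) (abs_bounded_prod h h) => //=.
by move=> y z _ _; exact: (can_inj eis_pairK).
Qed.

Lemma zeta_bounded t : 1 < complex.Re t ->
  abs_bounded [set k : nat | (0 < k)%N] (fun k => cpow (k%:R : R) (- t)).
Proof.
move=> t1; have h := nat_weight_bounded t1.
apply: (abs_bounded_complex (f := nat_weight (complex.Re t))); last first.
  exact: abs_bounded_subset h.
move=> k /= k0; rewrite cpow_norm ?ltr0n// lecR /nat_weight (maxn_idPr k0).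
by case: (t).
Qed.

Lemma zeta_has_sum t : 1 < complex.Re t ->
  has_sum [set k : nat | (0 < k)%N] (fun k => cpow (k%:R : R) (- t)) (zeta t).
Proof.
by move=> /zeta_bounded/has_sum_complex[l h]; rewrite /zeta (csum_has_sum h).
Qed.

(** Telescoping with 1 / (x + 1)^2 <= 1 / x - 1 / (x + 1), starting from 1 / 4 = 3 / 4 - 1 / 2. What
    matters is that the bound stays below 1. *)
Lemma inv_square_sum K : \sum_(0 <= k < K.+1) (k.+2%:R : R) ^- 2 <= 3 / 4 - K.+2%:R^-1.
Proof.
elim: K => [|K IH]; first by rewrite big_nat1; lra.
rewrite big_nat_recr//=; apply: le_trans (lerD IH (lexx _)) _.
rewrite -addrA lerD2l -lerBrDl opprK addrC.
set x : R := K.+2%:R; have x0 : 0 < x by rewrite ltr0n.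
have -> : K.+3%:R = x + 1 :> R by rewrite -natr1.
have -> : x^-1 - (x + 1)^-1 = (x * (x + 1))^-1 by field; rewrite !gt_eqF//; lra.
by rewrite lef_pV2 ?posrE; nra.
Qed.

(** The terms from 2 on have total modulus at most 3 / 4, less than the first term 1. The range Re t
    >= 2 contains 2 s for Re s > 1. *)
Lemma zeta_neq0 t : 2 <= complex.Re t -> zeta t != 0.
Proof.
move=> t2; have t1 : 1 < complex.Re t by lra.
suff h : `|zeta t - cpow ((1%N)%:R : R) (- t)| <= (3 / 4)%:C.
  apply/eqP => z0; move: h; rewrite z0 cpow1 sub0r normrN1.
  by rewrite -(rmorph1 (real_complex R)) lecR; lra.
apply: (@has_sum_dist_le _ _ _ _ _ _ 1%N _ (zeta_has_sum t1)) => //.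
move=> A hA nA.
have A2 k : k \in A -> (1 < k)%N.
  move=> kA; have /= := hA _ kA; case: k kA => [|[|k]]//; by rewrite (negbTE nA).
apply: le_trans (_ : (\sum_(k <- A) (k%:R : R) ^- 2)%:C <= _).
  rewrite rmorph_sum/= big_seq [leRHS]big_seq; apply: ler_sum => k kA.
  have k1 := A2 _ kA; have k0 : (0 : R) < k%:R by rewrite ltr0n; lia.
  rewrite cpow_norm// lecR -powR_invn ?ler0n//.
  apply: ler_powR; first by rewrite ler1n; lia.
  by case: (t) t2 => a b /=; rewrite lerN2.
rewrite lecR; pose K := (\max_(k <- A) k)%N.
apply: le_trans (_ : \sum_(0 <= k < K.+1) (k.+2%:R : R) ^- 2 <= _); last first.
  by apply: le_trans (inv_square_sum _) _; rewrite gerDl oppr_le0 invr_ge0 ler0n.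
have -> : \sum_(0 <= k < K.+1) (k.+2%:R : R) ^- 2 = \sum_(k <- iota 2 K.+1) (k%:R : R) ^- 2.
  rewrite /index_iota subn0 -[2%N]/(2 + 0)%N iotaDl big_map; apply: eq_bigr => k _.
  by rewrite add2n.
rewrite -(big_fset_of_seq (fun k : nat => (k%:R : R) ^- 2) (iota_uniq 2 K.+1)).
apply: ler_sum_fsubset => [|k]; last by rewrite invr_ge0 exprn_ge0 ?ler0n.
apply/fsubsetP => k kA; rewrite mem_fset_of_seq mem_iota A2//=.
have : (k <= K)%N by exact: leq_bigmax_seq. lia.
Qed.

Lemma one_sub_cpow_neq0 (p : nat) t : (1 < p)%N -> 0 < complex.Re t ->
  1 - cpow (p%:R : R) (- t) != 0.
Proof.
move=> p1 t0; rewrite subr_eq0; apply/eqP => h.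
have : `|cpow (p%:R : R) (- t)| = 1 by rewrite -h normr1.
rewrite cpow_norm ?ltr0n; last by lia.
rewrite (_ : complex.Re (- t) = - complex.Re t); last by case: (t).
move=> /(congr1 (@complex.Re R))/= /eqP; rewrite lt_eqF//.
by apply: powR_lt1 => //; rewrite ltr1n.
Qed.

(** The numbers prime to [ps] ([D]) split into those also prime to p ([D']) and the multiples p g
    with g in [D]. The latter sum to p^(-t) times the sum l over [D], so l = l' + p^(-t) l. *)
Lemma euler_has_sum t (ps : seq nat) : 1 < complex.Re t -> uniq ps -> all prime ps ->
  has_sum [set g | (0 < g)%N && all (fun p => ~~ (p %| g)%N) ps]
    (fun k : nat => cpow (k%:R : R) (- t)) (\prod_(p <- ps) (1 - cpow (p%:R : R) (- t)) * zeta t).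
Proof.
move=> t1; elim: ps => [|p ps IH].
  move=> _ _; rewrite big_nil mul1r.
  rewrite (_ : [set g | _] = [set k : nat | (0 < k)%N]); first exact: zeta_has_sum.
  by apply/seteqP; split => g /=; rewrite andbT.
move=> /= /andP[pps ups] /andP[pp aps]; have {IH} := IH ups aps.
set l := _ * zeta t; rewrite big_cons -mulrA -/l.
set D := [set g | _]; set D' := [set g | _] => hl.
have DD : D `<=` [set k : nat | (0 < k)%N] by move=> g /andP[].
have DD' : D' `<=` [set k : nat | (0 < k)%N] by move=> g /andP[].
have [l' hl'] := has_sum_complex (abs_bounded_subset DD' (zeta_bounded t1)).
pose pD := [set (p * g)%N | g in D].
have p0 := prime_gt0 pp.
have hp : has_sum pD (fun k : nat => cpow (k%:R : R) (- t)) (cpow (p%:R : R) (- t) * l).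
  refine (proj1 (@has_sum_reindex _ _ _ D pD (muln p) _ _ _ _ _ _ _) (has_sumZ (cpow (p%:R : R) (- t)) hl)).
  - by move=> g Dg; exists g.
  - by move=> g g' _ _ /eqP; rewrite eqn_pmul2l// => /eqP.
  - by move=> g /DD /= g0; rewrite natrM cpowM ?ltr0n.
  - by move=> y [g Dg <-] []; exists g.
have dis x : D' x -> pD x -> False.
  by move=> /= /andP[_ /andP[np _]] [g _ gE]; move: np; rewrite -gE dvdn_mulr.
have := has_sumU dis hl' hp.
have -> : D' `|` pD = D.
  apply/seteqP; split => g /=.
    move=> [/andP[g0 /andP[_ h]]|[g' /andP[g0 h] <-]]; first by rewrite /D/= g0.
    rewrite /D/= muln_gt0 p0 g0/=; apply/allP => q qps.
    rewrite Euclid_dvdM ?(allP aps _ qps)// negb_or (allP h)// andbT dvdn_prime2 ?(allP aps _ qps)//.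
    by apply: contra pps => /eqP qp; rewrite -{1}qp.
  move=> /andP[g0 h]; case pg : (p %| g)%N; last by left; rewrite /D'/= g0 pg h.
  right; exists (g %/ p)%N; last by rewrite mulnC divnK.
  rewrite /D/= divn_gt0// dvdn_leq//=; apply/allP => q qps.
  apply: contra (allP h _ qps) => qg; rewrite -(divnK pg); exact: dvdn_mulr.
move=> /(has_sum_unique hl) e.
by rewrite (_ : (1 - _) * l = l')// mulrBl mul1r {1}e addrK.
Qed.

End Convergence.

(** * Cosets of the translations in Gamma(3) *)

Section Cosets.
Set Implicit Arguments.
Unset Strict Implicit.
Local Open Scope classical_set_scope.

Lemma ord2P (i : 'I_2) : i = 0 \/ i = 1.
Proof. by case: i => [[|[|//]] h]; [left|right]; apply: val_inj. Qed.

(** A product of equations, so that it can be used as a rewriting multirule. *)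
Lemma mx2E (a b c d : int) : (mx2 a b c d 0 0 = a) * (mx2 a b c d 0 1 = b) *
  (mx2 a b c d 1 0 = c) * (mx2 a b c d 1 1 = d).
Proof. by rewrite !mxE. Qed.

Lemma mx2_eta (g : 'M[int]_2) : g = mx2 (g 0 0) (g 0 1) (g 1 0) (g 1 1).
Proof.
apply/matrixP => i j; rewrite mxE.
by case: (ord2P i) => ->; case: (ord2P j) => ->.
Qed.

Lemma mulmx2E (g h : 'M[int]_2) i j : (g *m h) i j = g i 0 * h 0 j + g i 1 * h 1 j.
Proof. by rewrite mxE !big_ord_recl big_ord0 addr0; congr (_ * _ + _ * _); congr (_ _ _); apply: val_inj. Qed.

Lemma det2E (g : 'M[int]_2) : \det g = g 0 0 * g 1 1 - g 0 1 * g 1 0.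
Proof.
rewrite (expand_det_row g 0) !big_ord_recl big_ord0 addr0 /cofactor !det_mx11 !mxE /=.
have -> : lift ord0 ord0 = 1 :> 'I_2 by apply: val_inj.
have -> : lift (1 : 'I_2) 0 = 0 :> 'I_2 by apply: val_inj.
by rewrite expr0 expr1; ring.
Qed.

Lemma mx2M (a b c d a' b' c' d' : int) : mx2 a b c d *m mx2 a' b' c' d' =
  mx2 (a * a' + b * c') (a * b' + b * d') (c * a' + d * c') (c * b' + d * d').
Proof. by rewrite [LHS]mx2_eta !mulmx2E !mx2E. Qed.

Lemma mx2_1 : mx2 1 0 0 1 = 1%:M.
Proof. by rewrite [RHS]mx2_eta !mxE. Qed.

Lemma translation_exp (k : int) : (Tmx ^+ 3) ^ k = mx2 1 (3 * k) 0 1.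
Proof.
have TM (a b : int) : mx2 1 a 0 1 * mx2 1 b 0 1 = mx2 1 (a + b) 0 1.
  by rewrite -mulmxE mx2M; congr mx2; ring.
have TX (k' : nat) : mx2 1 3 0 1 ^+ k' = mx2 1 (3 * k'%:Z) 0 1.
  elim: k' => [|k' IH]; first by rewrite expr0 mulr0 mx2_1.
  by rewrite exprS IH TM; congr mx2; lia.
have -> : Tmx ^+ 3 = mx2 1 3 0 1 by rewrite /Tmx !exprS expr0 mulr1 !TM.
case: k => k; first exact: TX.
rewrite NegzE -exprnN; apply: (@mulrI _ (mx2 1 3 0 1 ^+ k.+1)).
  apply/unitrP; exists (mx2 1 (- (3 * k.+1%:Z)) 0 1).
  by rewrite TX !TM addNr addrN mx2_1.
rewrite mulrV; last first.
  apply/unitrP; exists (mx2 1 (- (3 * k.+1%:Z)) 0 1).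
  by rewrite TX !TM addNr addrN mx2_1.
by rewrite TX TM; apply: etrans (esym mx2_1) _; congr mx2; lia.
Qed.

Lemma T3_cosetE (g h : 'M[int]_2) : T3_coset g h <->
  exists k : int, h = mx2 (g 0 0 + 3 * k * g 1 0) (g 0 1 + 3 * k * g 1 1) (g 1 0) (g 1 1).
Proof.
have E (k : int) : (Tmx ^+ 3) ^ k *m g = mx2 (g 0 0 + 3 * k * g 1 0) (g 0 1 + 3 * k * g 1 1) (g 1 0) (g 1 1).
  by rewrite translation_exp {1}(mx2_eta g) mx2M; congr mx2; ring.
split; first by move=> [k _ <-]; exists k; rewrite E.
by move=> [k ->]; exists k => //; rewrite E.
Qed.

Definition primitive_primary : set eis :=
  [set z | coprimez (eis_re z) (eis_om z) /\ eis_dvd 3 (z - 1)].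

Lemma primaryE (z : eis) : eis_dvd 3 (z - 1) <-> (3 %| eis_re z - 1)%Z /\ (3 %| eis_om z)%Z.
Proof. by rewrite eis_dvd_nat eis_reD eis_omD eis_reN eis_omN /= oppr0 addr0. Qed.

Lemma Gamma3E (g : 'M[int]_2) : Gamma3 g <->
  [/\ g 0 0 * g 1 1 - g 0 1 * g 1 0 = 1, (3 %| (g 0 0)%R - 1)%Z, (3 %| (g 0 1)%R)%Z,
      (3 %| (g 1 0)%R)%Z & (3 %| (g 1 1)%R - 1)%Z].
Proof.
rewrite /Gamma3 /= det2E; split.
  move=> [dg h]; split => //; rewrite -?eqz_mod_dvd.
  - by have := h 0 0; rewrite mxE/= => ->.
  - by have := h 0 1; rewrite mxE/=; lia.
  - by have := h 1 0; rewrite mxE/=; lia.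
  - by have := h 1 1; rewrite mxE/= => ->.
move=> [dg h1 h2 h3 h4]; split => // i j.
by case: (ord2P i) => ->; case: (ord2P j) => ->; rewrite mxE/=; lia.
Qed.

Lemma Gamma3_bottom_row (z : eis) : primitive_primary z ->
  exists g, [/\ Gamma3 g, g 1 0 = eis_om z & g 1 1 = eis_re z].
Proof.
move: z => [d c] [/= /coprimezP[[a0 b0] /= h] /primaryE[/= hd hc]].
(* Bezout gives the top row (a0, - b0). Adding b0 times the bottom row (c, d) keeps the determinant
   and makes the upper right entry b0 (d - 1), a multiple of 3. *)
exists (mx2 (a0 + b0 * c) (b0 * (d - 1)) c d); split; rewrite ?mx2E//.
apply/Gamma3E; rewrite !mx2E; split => //; last exact: dvdz_mull.
  have -> : (a0 + b0 * c) * d - b0 * (d - 1) * c = a0 * d + b0 * c by ring.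
  exact: h.
have -> : a0 + b0 * c - 1 = - a0 * (d - 1) + (a0 * d + b0 * c - 1) by ring.
rewrite h subrr addr0.
exact: dvdz_mull.
Qed.

Lemma Gamma3_primitive (g : 'M[int]_2) : Gamma3 g -> primitive_primary (Eis (g 1 1) (g 1 0)).
Proof.
move=> /Gamma3E[dg _ _ h3 h4]; split; last by apply/primaryE.
by apply/coprimezP; exists (g 0 0, - g 0 1) => /=; rewrite -dg; ring.
Qed.

(** For equal bottom rows, g times the inverse of h is the translation by b a' - a b', a multiple of
    3 because b and b' are. *)
Lemma T3_coset_eq (g h : 'M[int]_2) : Gamma3 g -> Gamma3 h ->
  g 1 0 = h 1 0 -> g 1 1 = h 1 1 -> T3_coset g = T3_coset h.
Proof.
suff main g' h' : Gamma3 g' -> Gamma3 h' -> g' 1 0 = h' 1 0 -> g' 1 1 = h' 1 1 ->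
    T3_coset g' `<=` T3_coset h'.
  by move=> hg hh e0 e1; apply/seteqP; split; apply: main.
move=> /Gamma3E[dg g1 g2 g3 g4] /Gamma3E[dh h1 h2 h3 h4] e0 e1 x /T3_cosetE[k ->].
move: dg dh g1 g2 g3 g4 h1 h2; rewrite e0 e1.
set a := g' 0 0; set b := g' 0 1; set a' := h' 0 0; set b' := h' 0 1.
set c := h' 1 0; set d := h' 1 1 => dg dh g1 g2 g3 g4 h1 h2.
have aE : a = a' + (b * a' - a * b') * c.
  have -> : a' + (b * a' - a * b') * c = a' * (1 - (a * d - b * c)) + a * (a' * d - b' * c) by ring.
  by rewrite dg dh; ring.
have bE : b = b' + (b * a' - a * b') * d.
  have -> : b' + (b * a' - a * b') * d = b' * (1 - (a * d - b * c)) + b * (a' * d - b' * c) by ring.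
  by rewrite dg dh; ring.
have /dvdzP[t tE] : (3 %| b * a' - a * b')%Z.
  by apply: rpredB; [exact: dvdz_mulr|exact: dvdz_mull].
rewrite tE in aE bE; apply/T3_cosetE; exists (t + k); rewrite -/a' -/b' -/c -/d.
by rewrite aE bE; congr mx2; ring.
Qed.

End Cosets.

(** * The sum over Gamma(3) *)

Section SquarefreePart.
Set Implicit Arguments.
Unset Strict Implicit.
Variable n : nat.
Hypothesis n_gt0 : (0 < n)%N.
Let n' := largest_squarefree_divisor n.

Lemma squarefreeP d : (0 < d)%N ->
  reflect (forall m, (m ^ 2 %| d)%N -> m = 1%N) (squarefree d).
Proof.
move=> d0; apply: (iffP forallP) => [h m md|h m]; last by apply/implyP => /h/eqP.
have m_le : (m < d.+1)%N.
  rewrite ltnS; have := dvdn_leq d0 md; apply: leq_trans; rewrite -mulnn.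
  by case: (m) => // k; rewrite leq_pmulr.
by have /implyP/(_ md)/eqP := h (Ordinal m_le).
Qed.

Lemma largest_squarefree_divisorP : [/\ (0 < n')%N, (n' %| n)%N & squarefree n'].
Proof.
have sq1 : squarefree 1.
  by apply/squarefreeP => // m; rewrite dvdn1 => /eqP; case: m => [|[|m]].
have le1 : (1 <= n')%N by apply: leq_bigmax_seq => //; rewrite -dvdn_divisors// dvd1n.
have : n' = 0%N \/ (n' %| n)%N /\ squarefree n'.
  rewrite /n' /largest_squarefree_divisor big_seq_cond.
  apply: (big_ind (fun x => x = 0%N \/ (x %| n)%N /\ squarefree x)); first by left.
    by move=> x y hx hy; rewrite /maxn; case: ifP.
  by move=> d; rewrite -dvdn_divisors// => /andP[dn sd]; right.
by case=> [n0|[]//]; move: le1; rewrite n0.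
Qed.

(** Otherwise p n' would be a larger squarefree divisor of n. *)
Lemma prime_dvd_squarefree_part p : prime p -> (p %| n)%N -> (p %| n')%N.
Proof.
move=> pp pn; have [n'0 n'n sq] := largest_squarefree_divisorP.
apply/negPn/negP => npn'; have p0 := prime_gt0 pp; have p1 := prime_gt1 pp.
have cop : coprime p n' by rewrite prime_coprime.
have pn'0 : (0 < p * n')%N by rewrite muln_gt0 p0.
suff : (p * n' <= n')%N by rewrite -{2}[n']mul1n leq_pmul2r// leqNgt p1.
apply: leq_bigmax_seq; first by rewrite -dvdn_divisors// Gauss_dvd// pn.
apply/squarefreeP => // m hm; case pm : (p %| m)%N.
  exfalso; move/negP: npn'; apply; rewrite -(dvdn_pmul2l p0).
  by apply: dvdn_trans hm; rewrite -mulnn dvdn_mul.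
apply: (elimT (squarefreeP n'0) sq); move: hm; rewrite Gauss_dvdr//.
by rewrite coprime_sym coprimeXr// prime_coprime// pm.
Qed.

Lemma primes_multiple_squarefree_part d : (d %| n)%N -> (n' %| d)%N -> primes d = primes n.
Proof.
move=> dn nd; have d0 := dvdn_gt0 n_gt0 dn.
apply/eq_primes => p; rewrite !mem_primes n_gt0 d0 /=.
case pp : (prime p) => //=; apply/idP/idP => [pd|pn]; first exact: dvdn_trans dn.
exact: dvdn_trans (prime_dvd_squarefree_part pp pn) nd.
Qed.

(** The divisors concerned are n' e with e dividing n / n', and each has the same primes as n, so
    the product factors out. *)
Lemma sum_multiples_squarefree_part (R : realType) :
  \sum_(d <- divisors n | (n' %| d)%N) (d%:R * n%:R * \prod_(p <- primes d) (1 - p%:R ^- 2)) =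
  (n%:R * n'%:R * (sigma (n %/ n'))%:R * \prod_(p <- primes n) (1 - p%:R ^- 2) : R).
Proof.
have [n'0 n'n _] := largest_squarefree_divisorP.
have nn'0 : (0 < n %/ n')%N by rewrite divn_gt0// dvdn_leq.
rewrite big_seq_cond [LHS](eq_bigr (fun d : nat => d%:R * (n%:R * \prod_(p <- primes n) (1 - p%:R ^- 2)))); last first.
  move=> d; rewrite -dvdn_divisors// => /andP[dn nd].
  by rewrite (primes_multiple_squarefree_part dn nd) mulrA.
rewrite -big_seq_cond -mulr_suml -[X in X * _ = _]big_filter.
have -> : \sum_(d <- [seq d <- divisors n | (n' %| d)%N]) (d%:R : R) =
    \sum_(d <- [seq (n' * e)%N | e <- divisors (n %/ n')]) (d%:R : R).
  apply: perm_big; apply: uniq_perm.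
  - by rewrite filter_uniq// divisors_uniq.
  - rewrite map_inj_uniq ?divisors_uniq// => a b /eqP.
    by rewrite eqn_pmul2l// => /eqP.
  move=> d; rewrite mem_filter -dvdn_divisors//; apply/andP/mapP.
    move=> [nd dn]; exists (d %/ n')%N; last by rewrite mulnC divnK.
    by rewrite -dvdn_divisors// dvdn_divRL// divnK.
  move=> [e]; rewrite -dvdn_divisors// => en ->.
  by rewrite dvdn_mulr// -(divnK n'n) mulnC dvdn_pmul2r.
rewrite big_map (_ : \sum_(e <- _) _ = n'%:R * (sigma (n %/ n'))%:R).
  by move: (\prod_(p <- _) _) => P; ring.
by rewrite /sigma natr_sum mulr_sumr; apply: eq_bigr => e _; rewrite natrM.
Qed.

End SquarefreePart.

(** * The summand in terms of the bottom row *)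

Section GammaSum.
Set Implicit Arguments.
Unset Strict Implicit.
Local Open Scope classical_set_scope.
Variables (R : realType) (n m : nat) (lam : 'I_m -> eis) (c : 'I_m -> nat).

(** The substitution c -> - c on bottom rows; unlike [eis_conj] it changes the norm, and it accounts
    for the matrix S. *)
Definition eis_star (z : eis) : eis := Eis (eis_re z) (- eis_om z).

(** The part of [Ccoef] without the character; it sees the row only through a norm k. *)
Definition Acoef (k : nat) : R :=
  \sum_(d <- divisors n | coprime d (gcdn n k))
     d%:R ^+ 2 * (f_arith R n / (3 * f_arith R d)) * \prod_(p <- primes d) (1 - p%:R ^- 2).

Definition Bcoef : R :=
  \sum_(d <- divisors n | (largest_squarefree_divisor n %| d)%N)
     d%:R * n%:R * \prod_(p <- primes d) (1 - p%:R ^- 2).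

Lemma Ccoef_bottom_row (z : eis) : Ccoef R n lam c (eis_re z) (- eis_om z) =
  Acoef (eis_norm z) + 2 / 3 * complex.Re (eisC R (chi lam c z)) * Bcoef.
Proof.
rewrite /Ccoef /Acoef /Bcoef; congr (_ + _ * complex.Re (eisC R (chi lam c _)) * _).
  by rewrite /eis_norm (_ : eis_re z ^+ 2 + _ + _ = eis_re z ^+ 2 - eis_re z * eis_om z + eis_om z ^+ 2)//; ring.
by apply: eis_ext => //=; rewrite opprK.
Qed.

(** For z = d + c w, the number c - d w is - w times the conjugate of d - c w, whose norm is c^2 + c
    d + d^2. *)
Lemma Ccoef_rotated (z : eis) : Ccoef R n lam c (eis_om z) (eis_re z) =
  Acoef (eis_norm (eis_star z)) +
  2 / 3 * complex.Re (eisC R (chi lam c (-1 * (eis_w * eis_conj (eis_star z))))) * Bcoef.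
Proof.
rewrite /Ccoef /Acoef /Bcoef; congr (_ + _ * complex.Re (eisC R (chi lam c _)) * _).
  rewrite /eis_norm/= (_ : eis_om z ^+ 2 + _ + _ =
    eis_re z ^+ 2 - eis_re z * - eis_om z + (- eis_om z) ^+ 2)//; ring.
by apply: eis_ext => /=; ring.
Qed.

(** The image of w is y / z = y conj(z) / N(z) with y = b + a w and z = d + c w, and the coefficient
    of w in y conj(z) is the determinant. *)
Lemma moebius_omega (g : 'M[int]_2) : \det g = 1 ->
  complex.Im (moebius g (omega R)) = Num.sqrt 3 / 2 / (eis_norm (Eis (g 1 1) (g 1 0)))%:R.
Proof.
rewrite det2E => dg; set z := Eis _ _; set y := Eis (g 0 1) (g 0 0).
have z0 : z <> 0.
  by move=> /(f_equal eis_pair) [e1 e0]; move: dg; rewrite e1 e0 !mulr0 subrr.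
have N0 : (eis_norm z)%:R != 0 :> R by rewrite pnatr_eq0 -lt0n eis_norm_gt0.
have -> : moebius g (omega R) = eisC R (y * eis_conj z) * ((eis_norm z)%:R^-1)%:C.
  rewrite /moebius eisCM eisC_conj.
  have -> : (g 0 0)%:~R * omega R + (g 0 1)%:~R = eisC R y by rewrite addrC.
  have -> : (g 1 0)%:~R * omega R + (g 1 1)%:~R = eisC R z by rewrite addrC.
  have zz : eisC R z * (eisC R z)^* = ((eis_norm z)%:R)%:C.
    by rewrite -sqr_normc eisC_sqnorm rmorph_nat.
  have N0C : ((eis_norm z)%:R)%:C != 0 :> R[i] by rewrite -(rmorph0 (real_complex R)) (inj_eq (@complexI R)).
  have ez0 : eisC R z != 0 by apply: contra N0C => /eqP e; rewrite -zz e mul0r.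
  rewrite fmorphV/=; apply: (canLR (mulfK ez0)).
  by rewrite mulrAC -[X in _ = X / _]mulrA [(eisC R z)^* * _]mulrC zz mulfK.
have omy : eis_om (y * eis_conj z) = 1 by rewrite -dg eis_omM /y /z /=; ring.
rewrite /eisC omy mul1r omegaE -(rmorph_int (real_complex R)) /=.
by field.
Qed.

End GammaSum.

(** * Evaluation of F at w *)

Section GammaSumEvaluation.
Set Implicit Arguments.
Unset Strict Implicit.
Local Open Scope classical_set_scope.
Variables (R : realType) (n m : nat) (lam : 'I_m -> eis) (c : 'I_m -> nat) (s : R[i]).
Hypothesis n_coprime3 : coprime n 3.
Hypothesis n_fact : eis_prime_factorization n lam c.
Hypothesis chi_w : chi lam c eis_w <> 1.
Hypothesis s_gt1 : 1 < complex.Re s.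

Let X (z : eis) : R[i] := eisC R (chi lam c z).
Let P (z : eis) : R[i] := cpow (eis_norm z)%:R (- s).
Let H : R[i] := cpow (Num.sqrt 3 / 2) s.

Lemma primitive_primary_neq0 z : primitive_primary z -> z <> 0.
Proof. by move=> [_ /primaryE[h _]] z0; move: h; rewrite z0. Qed.

Lemma primitive_primary_conj z : primitive_primary z -> primitive_primary (eis_conj z).
Proof.
case: z => a b [/= /coprimezP[[u v] /= h] /primaryE[/= h1 h2]]; split.
  by apply/coprimezP; exists (u, - (u + v)) => /=; rewrite -h; ring.
by apply/primaryE => /=; lia.
Qed.

Lemma primitive_primary_star z : primitive_primary z -> primitive_primary (eis_star z).
Proof.
case: z => a b [/= /coprimezP[[u v] /= h] /primaryE[/= h1 h2]]; split.
  by apply/coprimezP; exists (u, - v) => /=; rewrite -h; ring.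
by apply/primaryE => /=; lia.
Qed.

Lemma eis_star_involutive : involutive eis_star.
Proof. by move=> z; apply: eis_ext => //=; rewrite opprK. Qed.

Lemma has_sum_involution (T : choiceType) (D : set T) (i : T -> T) (f : T -> R[i]) l :
  (forall x, D x -> D (i x)) -> involutive i -> has_sum D f l -> has_sum D (fun x => f (i x)) l.
Proof.
move=> Di ii; refine (proj1 (@has_sum_reindex _ _ _ D D i f _ l _ _ _ _)) => //.
- by move=> x y _ _ /(can_inj ii).
- by move=> x _; rewrite ii.
- by move=> y Dy []; exists (i y) => //; exact: Di.
Qed.

Lemma chi_embed_norm_le1 z : `|X z| <= 1.
Proof.
rewrite /X; case: (pselect (chi lam c z = 0)) => [->|h0]; first by rewrite eisC0 normr0.
have h : `|eisC R (chi lam c z)| ^+ 3 = 1.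
  by rewrite -normrX -eisCX (chi_cube_neq0 n_coprime3 n_fact h0) eisC1 normr1.
by move/eqP: h; rewrite pexpr_eq1// => /eqP ->.
Qed.

Lemma primitive_primary_bounded : abs_bounded primitive_primary P.
Proof. exact: abs_bounded_subset primitive_primary_neq0 (eis_norm_bounded s_gt1). Qed.

Lemma chi_sum_bounded : abs_bounded primitive_primary (fun z => X z * P z).
Proof.
apply: (abs_bounded_le (c := 1)) primitive_primary_bounded => // z _.
by rewrite normrM ler_wpM2r ?chi_embed_norm_le1.
Qed.

(** Uniform in k, since k only selects a subset of the divisors. The first parts are thus summable
    by themselves and can be cancelled as a sum. *)
Lemma Acoef_bounded : exists2 M : R, 0 <= M & forall k, `|Acoef R n k| <= M.
Proof.
exists (\sum_(d <- divisors n)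
  `|d%:R ^+ 2 * (f_arith R n / (3 * f_arith R d)) * \prod_(p <- primes d) (1 - p%:R ^- 2)|).
  exact: sumr_ge0.
move=> k; apply: le_trans (ler_norm_sum _ _ _) _; rewrite big_mkcond/=.
by apply: ler_sum => d _; case: ifP.
Qed.

Lemma chi_embed_conj z : (X z)^* = X (eis_conj z).
Proof. by rewrite /X (chi_conj n_coprime3 n_fact) eisC_conj. Qed.

(** Here [chi_w] enters: a nontrivial cube root of unity and its conjugate add up to -1. *)
Lemma chi_embed_w_add_conj : X eis_w + conjc (X eis_w) = -1.
Proof.
have h0 : chi lam c eis_w <> 0 by apply: (chi_unit n_coprime3 n_fact).
rewrite chi_embed_conj /X (chi_conj n_coprime3 n_fact); have := chi_cube_neq0 n_coprime3 n_fact h0.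
move=> /eis_cube_root[//| -> | ->].
  by rewrite eisC_conj eisC_w omega_conj addrC subrK.
rewrite eisC_conj (_ : -1 - eis_w = eis_conj eis_w); last exact: eis_ext.
by rewrite eisC_conj eisC_w conjcK omega_conj subrK.
Qed.

(** Re X = (X + conj X) / 2 turns the coefficient 2 / 3 into 1 / 3 for each of chi(z) and chi(conj
    z). *)
Lemma bottom_row_term_expand z :
  (Acoef R n (eis_norm z) + 2 / 3 * complex.Re (X z) * Bcoef R n)%:C * (H * P z) =
  H * ((Acoef R n (eis_norm z))%:C * P z) +
  (H * (Bcoef R n)%:C / 3 * (X z * P z) + H * (Bcoef R n)%:C / 3 * (X (eis_conj z) * P z)).
Proof.
rewrite rmorphD/= !rmorphM/= ReJ_add chi_embed_conj fmorphV/= !rmorph_nat.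
by field.
Qed.

Lemma rotated_term_expand z :
  (Acoef R n (eis_norm z) +
   2 / 3 * complex.Re (X (-1 * (eis_w * eis_conj z))) * Bcoef R n)%:C * (H * P z) =
  H * ((Acoef R n (eis_norm z))%:C * P z) +
  (H * (Bcoef R n)%:C / 3 * X eis_w * (X (eis_conj z) * P z) +
   H * (Bcoef R n)%:C / 3 * (conjc (X eis_w)) * (X z * P z)).
Proof.
have -> : X (-1 * (eis_w * eis_conj z)) = X eis_w * X (eis_conj z).
  by rewrite /X !(chiM n_coprime3 n_fact) (chiN1 n_coprime3 n_fact) mul1r eisCM.
rewrite rmorphD/= !rmorphM/= ReJ_add fmorphV/= !rmorph_nat.
have -> : conjc (X eis_w * X (eis_conj z)) = conjc (X eis_w) * X z.
  by rewrite -{2}[z]eis_conjK -(chi_embed_conj (eis_conj z)); exact: (rmorphM (@conjc R)).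
by field.
Qed.

Lemma Ffun_eval (L : R[i]) : has_sum primitive_primary (fun z => X z * P z) L ->
  Ffun n lam c (omega R) s = (2 * pi / (3 * n%:R))%:C * (H * (Bcoef R n)%:C * L).
Proof.
move=> hL; rewrite /Ffun; congr (_ * _); apply: csum_has_sum.
have PJ z : P (eis_conj z) = P z by rewrite /P eis_norm_conj.
have hLc : has_sum primitive_primary (fun z => X (eis_conj z) * P z) L.
  apply: eq_has_sum (has_sum_involution primitive_primary_conj eis_conjK hL).
  by move=> z _; rewrite PJ.
have [M M0 hM] := Acoef_bounded.
have [al hA] : exists l, has_sum primitive_primary (fun z => (Acoef R n (eis_norm z))%:C * P z) l.
  apply: has_sum_complex; apply: (abs_bounded_le (c := M%:C)) primitive_primary_bounded.
    by rewrite ler0c.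
  move=> z _; rewrite normrM ler_wpM2r// normc_def/= expr0n/= addr0 sqrtr_sqr lecR.
  exact: hM.
have h1 := has_sumD (has_sumZ H hA)
  (has_sumD (has_sumZ (H * (Bcoef R n)%:C / 3) hL) (has_sumZ (H * (Bcoef R n)%:C / 3) hLc)).
(* The S-part of the coset of z is a term at [eis_star z]; as this is an involution of the index
   set, both halves are sums over the same set. *)
have h2 := has_sum_involution primitive_primary_star eis_star_involutive
  (has_sumD (has_sumZ H hA) (has_sumD (has_sumZ (H * (Bcoef R n)%:C / 3 * X eis_w) hLc)
     (has_sumZ (H * (Bcoef R n)%:C / 3 * (conjc (X eis_w))) hL))).
have := has_sumD h1 (has_sumZ (-1) h2).
set l := (X in has_sum _ _ X).
(* The [Acoef] sums cancel, and the rest is (H B / 3)(2 - (a + b)) L with a + b = -1, hence H B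
   L. *)
have -> : l = H * (Bcoef R n)%:C * L.
  rewrite /l; move: chi_embed_w_add_conj; move: (X eis_w) (conjc (X eis_w)) => a b ab.
  have -> : b = -1 - a by rewrite -ab addrC addKr.
  by field.
have /choice[G hG] : forall z, exists g, primitive_primary z ->
    [/\ Gamma3 g, g 1 0 = eis_om z & g 1 1 = eis_re z].
  move=> z; case: (pselect (primitive_primary z)) => [/Gamma3_bottom_row[g hg]|hz].
    by exists g.
  by exists 1%:M.
refine (proj1 (@has_sum_reindex _ _ _ primitive_primary T3_quotient (fun z => T3_coset (G z)) _ _ _ _ _ _ _)).
- by move=> z hz; exists (G z) => //; have [] := hG z hz.
- move=> z z' hz hz' e; have [_ z1 z2] := hG _ hz; have [_ z3 z4] := hG _ hz'.
  have : T3_coset (G z') (G z).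
    by rewrite -e; apply/T3_cosetE; exists 0; rewrite {1}[G z]mx2_eta; congr mx2; ring.
  by move=> /T3_cosetE[k gE]; apply: eis_ext; rewrite -?z1 -?z2 gE mx2E ?z3 ?z4.
- move=> z hz; have [hg g0 g1] := hG _ hz.
  (* The summand uses the chosen representative, of which only membership in the coset is known;
     that already fixes its bottom row and determinant. *)
  have : T3_coset (G z) (xget 1%:M (T3_coset (G z))).
    apply: (@xgetI _ _ _ (G z)); apply/T3_cosetE; exists 0.
    by rewrite {1}[G z]mx2_eta; congr mx2; ring.
  move: (xget _ _) => g /T3_cosetE[k gE] /=.
  have e0 : g 1 0 = eis_om z by rewrite gE mx2E.
  have e1 : g 1 1 = eis_re z by rewrite gE mx2E.
  have dg : \det g = 1.
    by have /Gamma3E[dG _ _ _ _] := hg; rewrite det2E gE !mx2E -dG; ring.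
  have h0 : 0 < Num.sqrt 3 / 2 :> R by rewrite divr_gt0// sqrtr_gt0.
  have N0 y : primitive_primary y -> 0 < (eis_norm y)%:R :> R.
    by move=> /primitive_primary_neq0 y0; rewrite ltr0n eis_norm_gt0.
  rewrite e0 e1 Ccoef_bottom_row Ccoef_rotated moebius_omega// e0 e1.
  rewrite moebius_omega; last by rewrite det_mulmx dg mul1r det2E !mx2E.
  have -> : eis_norm (Eis ((g *m Smx) 1 1) ((g *m Smx) 1 0)) = eis_norm (eis_star z).
    by rewrite !mulmx2E e0 e1 !mx2E /eis_norm /=; congr absz; ring.
  rewrite (_ : Eis (eis_re z) (eis_om z) = z); last by case: (z).
  rewrite (cpow_div s h0 (N0 _ hz)) (cpow_div s h0 (N0 _ (primitive_primary_star hz))).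
  have p1 := bottom_row_term_expand z; have p2 := rotated_term_expand (eis_star z).
  by rewrite /X /H /P in p1 p2 *; rewrite p1 p2 mulN1r.
- move=> K [g hg <-] []; have hz := Gamma3_primitive hg.
  exists (Eis (g 1 1) (g 1 0)) => //; have [hg' e0 e1] := hG _ hz.
  exact: T3_coset_eq.
Qed.

End GammaSumEvaluation.

(** * The L-function as a sum over primitive elements *)

Section PrincipalIdeals.
Set Implicit Arguments.
Unset Strict Implicit.
Local Open Scope classical_set_scope.
Implicit Types (x y z u : eis).

Definition principal z : set eis := [set w * z | w in [set: eis]].

Lemma principal_refl z : principal z z.
Proof. by exists 1 => //; rewrite mul1r. Qed.

Lemma principal_ideal z : is_ideal (principal z).
Proof.
split; first by exists 0 => //; rewrite mul0r.
- by move=> x y [a _ <-] [b _ <-]; exists (a + b) => //; rewrite mulrDl.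
- by move=> a x [b _ <-]; exists (a * b) => //; rewrite mulrA.
Qed.

Lemma principal_unit u z : eis_norm u = 1%N -> principal (u * z) = principal z.
Proof.
move=> /eis_norm_unit hu; apply/seteqP; split => x [w _ <-].
  by exists (w * u) => //; rewrite mulrA.
exists (w * eis_conj u) => //.
have -> : w * eis_conj u * (u * z) = w * (u * eis_conj u) * z by ring.
by rewrite hu mulr1.
Qed.

Lemma principal_eq x y : x <> 0 -> principal x = principal y ->
  exists2 u, eis_norm u = 1%N & x = u * y.
Proof.
move=> x0 e; have [v _ vE] : principal y x by rewrite -e; exact: principal_refl.
have [w _ wE] : principal x y by rewrite e; exact: principal_refl.
exists v => //; have vw : v * w = 1.
  by apply: (eis_mulI x0); rewrite mulr1 -{2}vE -wE; ring.
by have := congr1 eis_norm vw; rewrite eis_normM eis_norm1 => /eqP; rewrite muln_eq1 => /andP[/eqP].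
Qed.

(** The generators differ by a unit that is 1 modulo 3, hence by 1. *)
Lemma primary_unique x y : eis_dvd 3 (x - 1) -> eis_dvd 3 (y - 1) ->
  principal x = principal y -> x = y.
Proof.
move=> hx hy e; have x0 : x <> 0.
  by move=> x0; move: hx => /primaryE[]; rewrite x0.
have [u hu xE] := principal_eq x0 e; rewrite xE (_ : u = 1) ?mul1r//.
apply: eis_unit_primary => //; rewrite xE in hx.
have -> : u - 1 = (u * y - 1) - u * (y - 1) by ring.
by apply: eis_dvdB => //; exact: eis_dvdMl.
Qed.

Lemma primary_gen_principal y : eis_dvd 3 (y - 1) -> primary_gen (principal y) = y.
Proof.
move=> hy; rewrite /primary_gen; set A := [set z | _].
have [e h] : A (xget 0 A) by apply: (@xgetI _ 0 A y); split.
by apply: primary_unique.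
Qed.

Lemma eis_dvd_nat_primitive (g k : nat) z : coprimez (eis_re z) (eis_om z) ->
  eis_dvd g%:R (k%:R * z) -> (g %| k)%N.
Proof.
move=> /coprimezP[[a b] /= h] /eis_dvd_nat; rewrite eis_nat eis_reM eis_omM /= !mul0r subr0 addr0 subr0.
move=> [h1 h2]; have : (g %| k%:Z)%Z.
  have -> : k%:Z = a * (k%:Z * eis_re z) + b * (k%:Z * eis_om z).
    by rewrite -[LHS]mulr1 -h; ring.
  by apply: rpredD; apply: dvdz_mull.
by [].
Qed.

(** For a rational integer the primary associate is reached by a sign, to which [chi] is blind. *)
Lemma primary_sign (g : nat) : ~~ (3 %| g)%N ->
  exists2 u : eis, u = 1 \/ u = -1 & eis_dvd 3 (u * g%:R - 1).
Proof.
move=> h3; have [h|h] : (g %% 3 = 1)%N \/ (g %% 3 = 2)%N by lia.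
  exists 1; first by left.
  by apply/primaryE; rewrite mul1r eis_nat /=; split => //; lia.
exists (-1); first by right.
apply/primaryE; rewrite eis_nat eis_reM eis_omM /= !(oppr0, mul0r, mulr0, subr0, addr0).
by split => //; lia.
Qed.

End PrincipalIdeals.

(** * Ideals prime to 3n as products, and the L-function *)

Section LFunction.
Set Implicit Arguments.
Unset Strict Implicit.
Local Open Scope classical_set_scope.
Variables (R : realType) (n m : nat) (lam : 'I_m -> eis) (c : 'I_m -> nat) (s : R[i]).
Hypothesis n_gt0 : (0 < n)%N.
Hypothesis n_coprime3 : coprime n 3.
Hypothesis n_fact : eis_prime_factorization n lam c.
Hypothesis s_gt1 : 1 < complex.Re s.

Let G := [set g | (0 < g)%N && all (fun p => ~~ (p %| g)%N) (3%N :: primes n)].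
Let Q := [set z | primitive_primary z /\ chi lam c z <> 0].

Lemma coprime_of_ndvd_primes g : G g -> [/\ (0 < g)%N, ~~ (3 %| g)%N & coprime g n].
Proof.
move=> /andP[g0 /= /andP[h3 h]]; split => //.
apply/negPn/negP => ncop; have gcd1 : (1 < gcdn g n)%N.
  have : (0 < gcdn g n)%N by rewrite gcdn_gt0 g0.
  by move: ncop; rewrite /coprime; case: (gcdn g n) => [|[|]].
have pp := pdiv_prime gcd1; have pd := pdiv_dvd (gcdn g n).
have : pdiv (gcdn g n) \in primes n.
  by rewrite mem_primes pp n_gt0 (dvdn_trans pd (dvdn_gcdr _ _)).
by move=> /(allP h); rewrite (dvdn_trans pd (dvdn_gcdl _ _)).
Qed.

Lemma chi_sign u : u = 1 \/ u = -1 -> eis_norm u = 1%N /\ chi lam c u = 1.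
Proof.
move=> [->|->]; split => //; last exact: (chiN1 n_coprime3 n_fact).
exact: (chi_nat n_coprime3 n_fact (coprime1n n)).
Qed.

Lemma ideal_coprime_product g z : G g -> Q z -> ideal_coprime (principal (g%:R * z)) (3 * n).
Proof.
move=> /coprime_of_ndvd_primes[g0 g3 gn] [[cz z1] chiz].
have [u us hu] := primary_sign g3.
suff [a [b h]] : exists a b, a * (g%:R * z) + b * (3%:R * n%:R) = 1.
  by exists (a * (g%:R * z)); [exists a|exists b; rewrite natrM [_ * b]mulrC].
apply: eis_bezoutM.
  have [q hq] : eis_dvd 3 (u * (g%:R * z) - 1).
    have -> : u * (g%:R * z) - 1 = (u * g%:R - 1) * z + (z - 1) by ring.
    by apply: eis_dvdD => //; exact: eis_dvdMr.
  by exists u, (- q); rewrite mulNr -hq; ring.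
apply: (chi_coprime n_fact) => i; have [_ _ pr] := lam_prime n_fact i.
move=> /pr[hg|hz]; last by move: chiz => /(chi_neq0 n_coprime3 n_fact)/(_ i).
have : chi lam c g%:R <> 0 by rewrite (chi_nat n_coprime3 n_fact gn); apply/eqP/oner_neq0.
by move=> /(chi_neq0 n_coprime3 n_fact)/(_ i).
Qed.

(** A generator is made primary by a unit u and divided by its content g; the sign v that makes g
    primary then makes the primitive part v z' primary too. *)
Lemma coprime_ideal_product (I : set eis) : is_ideal I -> ideal_coprime I (3 * n) ->
  exists g z, [/\ G g, Q z & I = principal (g%:R * z)].
Proof.
move=> idI [x Ix [y xy]].
(* All coprimality claims below reduce to this: a common divisor of x and 3n divides x + 3n y =
   1. *)
have no_common d : eis_dvd d x -> eis_dvd d (3 * n)%:R -> eis_norm d = 1%N.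
  move=> h1 h2; have : eis_dvd d 1 by rewrite -xy; apply: eis_dvdD => //; exact: eis_dvdMr.
  by move=> /eis_dvd_norm; rewrite eis_norm1 dvdn1 => /eqP.
have x0 : x <> 0.
  move=> x0; have := no_common (3 * n)%:R; rewrite x0 => /(_ (eis_dvd0 _) (eis_dvd_refl _)).
  by rewrite eis_norm_nat -mulnn => /eqP; rewrite !muln_eq1.
have [z z0 IE] := eis_ideal_principal idI (ex_intro2 _ _ x Ix x0).
have zx : eis_dvd z x by move: Ix; rewrite IE => -[w _ <-]; exists w.
(* N(z) divides N(x), and x = 1 - 3 n y has norm 1 modulo 3. *)
have z3 : ~~ (3 %| eis_norm z)%N.
  apply/negP => h; have := dvdn_trans h (eis_dvd_norm zx).
  have -> : x = 1 - 3 * (n%:R * y) by rewrite -[LHS](addrK ((3 * n)%:R * y)) xy natrM; ring.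
  rewrite -[(_ %| _)%N]/((3 %| (eis_norm (1 - 3 * (n%:R * y)))%:Z)%Z) eis_normE.
  move: (n%:R * y) => [a b]; rewrite /enorm eis_reD eis_omD eis_reN eis_omN eis_reM eis_omM /=.
  set N := (X in (_ %| X)%Z).
  have -> : N = 1 + 3 * (- 2 * a + b + 3 * (a ^+ 2 - a * b + b ^+ 2)) by rewrite /N; ring.
  by move: (_ + _ * (_ ^+ 2 - _ + _)) => t; lia.
have [u hu uz] := eis_primary_associate z3.
have uz0 : u * z <> 0.
  by move=> e; move: uz => /primaryE[]; rewrite e.
have [g [z' [g0 uzE cz']]] := eis_content uz0.
have g3 : ~~ (3 %| g)%N.
  apply/negP => /dvdnP[k gE]; move: uz => /primaryE[+ _].
  by rewrite uzE gE eis_nat eis_reM /= mul0r subr0; lia.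
have [v vs hv] := primary_sign g3; have [v1 _] := chi_sign vs.
have vv : v * v = 1 by case: vs => ->; rewrite ?mulr1// mulrNN mulr1.
have IE' : I = principal (g%:R * (v * z')).
  have -> : g%:R * (v * z') = v * (u * z) by rewrite uzE; ring.
  by rewrite principal_unit// principal_unit.
have gx : eis_dvd (g%:R * (v * z')) x.
  by move: Ix; rewrite IE' => -[w _ <-]; exists w.
exists g, (v * z'); split => //.
- apply/andP; split => //; apply/allP => p pin; apply/negP => /dvdnP[k gE].
  have pp : prime p by move: pin; rewrite inE => /orP[/eqP ->//|]; rewrite mem_primes => /and3P[].
  have pn : (p %| 3 * n)%N.
    move: pin; rewrite inE => /orP[/eqP ->|]; first exact: dvdn_mulr.
    by rewrite mem_primes => /and3P[_ _ h]; exact: dvdn_mull.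
  have : eis_norm p%:R = 1%N.
    apply: no_common.
      by apply: eis_dvd_trans gx; exists (k%:R * (v * z')); rewrite gE natrM; ring.
    by have /dvdnP[q ->] := pn; exists q%:R; rewrite natrM.
  by rewrite eis_norm_nat -mulnn => /eqP; rewrite muln_eq1 => /andP[/eqP p1 _]; move: pp; rewrite p1.
- split; first split.
  + case: vs => ->; first by rewrite mul1r.
    have /coprimezP[[a b] /= h] := cz'.
    have {h} : coprimez (- eis_re z') (- eis_om z').
      by apply/coprimezP; exists (- a, - b) => /=; rewrite -h; ring.
    by apply: etrans; congr coprimez => /=; ring.
  + have -> : v * z' - 1 = (g%:R * z' - 1) - v * (v * g%:R - 1) * z' + (v * v - 1) * g%:R * z' by ring.
    rewrite vv subrr !mul0r addr0; apply: eis_dvdB; first by rewrite -uzE.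
    by apply: eis_dvdMr; exact: eis_dvdMl.
  + apply/(chi_neq0 n_coprime3 n_fact) => i hd.
    have := eis_prime_norm (lam_prime n_fact i); rewrite no_common//.
      by apply: eis_dvd_trans gx; exact: eis_dvdMl.
    by rewrite natrM; apply: eis_dvdMl; exact: (lam_dvd_n n_fact).
Qed.

(** As z and z' are primitive, the contents g and g' divide each other; then z and z' generate the
    same ideal and are both primary. *)
Lemma ideal_product_inj g z g' z' : G g -> Q z -> G g' -> Q z' ->
  principal (g%:R * z) = principal (g'%:R * z') -> g = g' /\ z = z'.
Proof.
move=> /coprime_of_ndvd_primes[g0 _ _] [[cz z1] _] /coprime_of_ndvd_primes[g0' _ _] [[cz' z1'] _].
have div k k' y y' : (0 < k)%N -> coprimez (eis_re y') (eis_om y') ->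
    principal (k%:R * y) = principal (k'%:R * y') -> (k %| k')%N.
  move=> k0 cy e; apply: (eis_dvd_nat_primitive cy).
  have [w _ <-] : principal (k%:R * y) (k'%:R * y') by rewrite e; exact: principal_refl.
  by exists (w * y); ring.
move=> e; have gg : g = g'.
  by apply/eqP; rewrite eqn_dvd (div _ _ _ _ g0 cz' e) (div _ _ _ _ g0' cz (esym e)).
split => //; apply: primary_unique => //.
have gne : g%:R <> 0 :> eis.
  by move=> /(congr1 eis_norm); rewrite eis_norm_nat eis_norm0 => /eqP; rewrite expn_eq0 (gtn_eqF g0).
have z0 : z <> 0 by exact: primitive_primary_neq0.
have gz0 : g%:R * z <> 0 by move=> /eis_mul_eq0[].
have [u hu uE] := principal_eq gz0 e.
have -> : z = u * z' by apply: (eis_mulI gne); rewrite uE -gg; ring.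
exact: principal_unit.
Qed.

Lemma Lk_eval (L : R[i]) :
  has_sum primitive_primary (fun z => eisC R (chi lam c z) * cpow (eis_norm z)%:R (- s)) L ->
  Lk (3 * n) (fun z => eisC R (chi lam c z)) s =
    \prod_(p <- 3%N :: primes n) (1 - cpow (p%:R : R) (- (2 * s))) * zeta (2 * s) * L.
Proof.
move=> hL; apply: csum_has_sum.
set f := fun z => _ in hL.
(* The z with chi(z) = 0 contribute nothing, and dropping them leaves exactly those whose multiples
   can be prime to 3n. *)
have hQ : has_sum Q f L.
  refine (proj2 (@has_sum_reindex _ _ _ Q primitive_primary id f f L _ _ _ _) hL) => //.
    by move=> z [].
  move=> z hz nz; rewrite /f; case: (pselect (chi lam c z = 0)) => [->|h].
    by rewrite eisC0 mul0r.
  by exfalso; apply: nz; exists z.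
have s2 : 1 < complex.Re (2 * s).
  by rewrite mulr_natl mulr2n; move: s_gt1; case: (s) => a b /=; lra.
have hG : has_sum G (fun k : nat => cpow (k%:R : R) (- (2 * s)))
    (\prod_(p <- 3%N :: primes n) (1 - cpow (p%:R : R) (- (2 * s))) * zeta (2 * s)).
  apply: euler_has_sum => //=; first rewrite primes_uniq andbT.
    by rewrite mem_primes n_gt0 /= -prime_coprime// coprime_sym.
  by apply/allP => p; rewrite mem_primes => /and3P[].
have bG : abs_bounded G (fun k : nat => cpow (k%:R : R) (- (2 * s))).
  by apply: abs_bounded_subset (zeta_bounded s2) => g /andP[].
have bQ : abs_bounded Q f.
  by apply: abs_bounded_subset (chi_sum_bounded n_coprime3 n_fact s_gt1) => z [].
(* Absolute boundedness gives the double sum some limit, which [has_sumM] identifies as the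
   product. *)
have [l hl] := has_sum_complex (abs_bounded_prod bG bQ).
rewrite -(has_sumM hG hQ hl).
refine (proj1 (@has_sum_reindex _ _ _ _ _ (fun gz => principal (gz.1%:R * gz.2)) _ _ _ _ _ _ _) hl).
- move=> [g z] [/= hg hz]; split; first exact: principal_ideal.
  exact: ideal_coprime_product.
- move=> [g z] [g' z'] [/= hg hz] [/= hg' hz'] e.
  by have [-> ->] := ideal_product_inj hg hz hg' hz' e.
- move=> [g z] [/= hg [[cz z1] chiz]]; have [g0 g3 gn] := coprime_of_ndvd_primes hg.
  have z0 : z <> 0 by exact: primitive_primary_neq0.
  have gne : g%:R <> 0 :> eis.
    by move=> /(congr1 eis_norm); rewrite eis_norm_nat eis_norm0 => /eqP; rewrite expn_eq0 (gtn_eqF g0).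
  (* [Lk] evaluates the character at the primary generator, which is u g z with u = 1 or -1; there
     chi takes the value chi(z), and N(g z) = g^2 N(z) yields the exponent 2 s. *)
  have [u us hu] := primary_sign g3; have [u1 chiu] := chi_sign us.
  rewrite ideal_norm_principal; last by move=> /eis_mul_eq0[].
  rewrite -(principal_unit _ u1) primary_gen_principal; last first.
    have -> : u * (g%:R * z) - 1 = (u * g%:R - 1) * z + (z - 1) by ring.
    by apply: eis_dvdD => //; exact: eis_dvdMr.
  rewrite !(chiM n_coprime3 n_fact) chiu (chi_nat n_coprime3 n_fact gn) !mul1r.
  rewrite eis_normM eis_norm_nat natrM natrX cpowM; last 2 first.
  - by rewrite exprn_gt0// ltr0n.
  - by rewrite ltr0n eis_norm_gt0.
  by rewrite cpow_sqr ?ltr0n// /f; ring.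
- move=> I [idI cI] []; have [g [z [hg hz ->]]] := coprime_ideal_product idI cI.
  by exists (g, z).
Qed.

End LFunction.

(** * Assembly of the formula *)

Theorem theorem4p12 (R : realType) (n : nat) (m : nat) (lam : 'I_m -> eis)
    (c : 'I_m -> nat) (s : R[i])
    (n_gt0 : (0 < n)%N)
    (n_coprime6 : coprime n 6)
    (n_mod9 : (n%:Z <> 1 %[mod 9])%Z /\ (n%:Z <> -1 %[mod 9])%Z)
    (n_exponents : forall p : nat, p \in primes n -> ~~ (3 %| logn p n)%N)
    (n_factorization : eis_prime_factorization n lam c)
    (s_gt1 : 1 < complex.Re s) :
  let n' := largest_squarefree_divisor n in
  Ffun n lam c (omega R) s =
    (2 * pi * n'%:R * (sigma (n %/ n'))%:R)%:C / (3 * (1 - cpow 3 (- (2 * s))))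
    * cpow (Num.sqrt 3 / 2) s
    * (Lk (3 * n) (fun z => eisC R (chi lam c z)) s / zeta (2 * s))
    * \prod_(p <- primes n)
        ((1 - p%:R ^- 2) / (1 - cpow (p%:R : R) (- (2 * s)))).
Proof.
move=> n'.
have c3 : coprime n 3 by move: n_coprime6; rewrite (coprimeMr n 2 3) => /andP[].
have chi_w : chi lam c eis_w <> 1.
  apply: (chi_w_neq1 c3 n_factorization); apply/eqP => h; have [h1 h8] := n_mod9.
    by apply: h1; lia.
  by apply: h8; lia.
have [L hL] := has_sum_complex (chi_sum_bounded c3 n_factorization s_gt1).
have s2 : 2 <= complex.Re (2 * s).
  by rewrite mulr_natl mulr2n; move: s_gt1; case: (s) => a b /=; lra.
have s0 : 0 < complex.Re (2 * s) by lra.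
rewrite (Ffun_eval c3 n_factorization chi_w s_gt1 hL).
rewrite (Lk_eval n_gt0 c3 n_factorization s_gt1 hL).
rewrite /Bcoef (sum_multiples_squarefree_part n_gt0) -/n' big_cons prodf_div.
have z0 := zeta_neq0 s2.
have c30 := @one_sub_cpow_neq0 R 3 (2 * s) isT s0.
have n0 : (n%:R : R[i]) != 0 by rewrite pnatr_eq0 -lt0n.
have P0 : \prod_(p <- primes n) (1 - cpow (p%:R : R) (- (2 * s))) != 0.
  rewrite prodf_seq_neq0; apply/allP => p; rewrite mem_primes => /and3P[pp _ _] /=.
  by apply: one_sub_cpow_neq0 => //; exact: prime_gt1.
(* The statement takes this product in [R[i]], while the one in [Bcoef] is real; they are identified
   before clearing denominators. *)
have -> : (\prod_(p <- primes n) (1 - p%:R ^- 2) : R[i]) =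
    (\prod_(p <- primes n) (1 - p%:R ^- 2) : R)%:C.
  rewrite rmorph_prod; apply: eq_bigr => p _.
  by rewrite rmorphB rmorph1 fmorphV rmorphXn rmorph_nat.
set E1 := \prod_(p <- primes n) (1 - cpow (p%:R : R) (- (2 * s))) in P0 *.
set E2 : R := \prod_(p <- primes n) _.
move: E1 E2 P0 z0 c30 => E1 E2.
move: (zeta _) (cpow 3 (- (2 * s))) (cpow _ s) => z q h P0 z0 c30.
rewrite !rmorphM/= fmorphV/= !rmorphM/= !rmorph_nat.
by field; rewrite z0 c30 P0 n0.
Qed.
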